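(* Any tester for determining whether a bipartite pure state has exactly $r$ nonzero Schmidt coefficients all equal to $1/\sqrt r$, or exactly $r+\Delta$ nonzero Schmidt coefficients all equal to $1/\sqrt{r+\Delta}$, requires sample complexity $\mathsf{S}(\textsc{UniformSchmidtCoefficients}^{r,\Delta})=\Omega^*(r^2/\Delta)$.
   Context: Here $\textsc{UniformSchmidtCoefficients}^{r,\Delta}=(\mathcal{Q}^r,\mathcal{Q}^{r+\Delta})$ where $\mathcal{Q}^s$ is the set of pure states in $\mathbb{C}^d\otimes\mathbb{C}^d$ with exactly $s$ nonzero Schmidt coefficients, each equal to $1/\sqrt s$. $\Omega^*(\cdot)$ suppresses quasi-polylogarithmic factors such as $r^{o(1)}$. $\mathsf{S}(\cdot)$ is the minimum $N$ such that some $0\preceq\mathcal{T}\preceq I$ on $N$ copies accepts yes-instances w.p. $\ge2/3$ and no-instances w.p. $\le1/3$. *)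

(* Defs.v *)
From HB Require Import structures.
From mathcomp Require Import all_boot all_order all_algebra.
From mathcomp Require Import complex.
From mathcomp Require Import reals exp.
Set Implicit Arguments. Unset Strict Implicit. Unset Printing Implicit Defensive.
Import Order.TTheory GRing.Theory Num.Theory.
Local Open Scope ring_scope.

Section Defs.
Variable C : numClosedFieldType.

(* A pure state psi in C^d (x) C^d is stored as its coefficient matrix:
   psi = sum_{i,j} psi i j |i> (x) |j>. *)

(* psi has a Schmidt decomposition with exactly s terms, all with coefficient
   1/sqrt s:  psi = sum_{k<s} (1/sqrt s) a_k (x) b_k, with (a_k), (b_k)
   orthonormal families (columns of isometries A, B). *)
Definition uniform_schmidt (d s : nat) (psi : 'M[C]_d) : Prop :=
  exists (A B : 'M[C]_(d, s)),
    (map_mx Num.conj A)^T *m A = 1%:M /\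
    (map_mx Num.conj B)^T *m B = 1%:M /\
    psi = (sqrtC (s%:R))^-1 *: (A *m B^T).

(* Computational basis of (C^d (x) C^d)^{(x) N}: one pair of indices per copy. *)
Definition copies_idx (d N : nat) := {ffun 'I_N -> 'I_d * 'I_d}.

Definition tens_pow (d N : nat) (psi : 'M[C]_d) (f : copies_idx d N) : C :=
  \prod_(k < N) psi (f k).1 (f k).2.

Definition qform (I : finType) (T : I -> I -> C) (v : I -> C) : C :=
  \sum_(x : I) \sum_(y : I) (v x)^* * T x y * v y.

Definition is_effect (I : finType) (T : I -> I -> C) : Prop :=
  forall v : I -> C, 0 <= qform T v /\ qform T v <= \sum_(x : I) (v x)^* * v x.

Definition usc_tester (d r Delta N : nat) (T : copies_idx d N -> copies_idx d N -> C)
  : Prop :=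
  is_effect T /\
  (forall psi, @uniform_schmidt d r psi -> 2%:R / 3%:R <= qform T (@tens_pow d N psi)) /\
  (forall psi, @uniform_schmidt d (r + Delta) psi ->
     qform T (@tens_pow d N psi) <= 1 / 3%:R).

End Defs.

(* Main.v *)
Require Import Defs.
From HB Require Import structures.
From mathcomp Require Import all_boot all_order all_algebra.
From mathcomp Require Import complex.
From mathcomp Require Import reals exp.
From mathcomp Require Import all_fingroup sesquilinear spectral.
From mathcomp Require all_classical topology normedtype derive.
From mathcomp Require Import zify ring lra.
Set Implicit Arguments. Unset Strict Implicit. Unset Printing Implicit Defensive.
Import Order.TTheory GRing.Theory Num.Theory.
Local Open Scope ring_scope.

(** Testers form a compact convex set that is invariant under local unitaries, so a
tester of minimal Hilbert-Schmidt norm is invariant; by Schur-Weyl duality it is a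
combination of the operators [p (x) q], with [p], [q] in S_N permuting the copies of
either party.  Its acceptance probability on a uniform state of rank [s] is then a
combination of the normalized traces [s^(-|p|)].  These are the coefficients of the
product over [m] of [1 + J_m / s], where the Jucys-Murphy elements [J_m] commute, so
ranks [r] and [r + Delta] give two probability distributions on the joint spectrum
[c] of the [J_m] with densities [prod_m (1 + c_m / s)], and a tester forces their
Bhattacharyya coefficient to stay away from 1.  That coefficient loses at most
[(1/r - 1/(r+Delta))^2 m / 2] at step [m], because [J_m] has conditional mean 0 and
variance [m], up to the contribution of [c_m < - r / 2]; the latter is negligible by
Markov's inequality for the moments of [J_m], as long as [N <= r^(2 - eps)]. *)

(** * Colorings fixed by a permutation *)

(** The rank [r + Delta] state can be taken maximally entangled, because a tester restricts to local
    dimension [r + Delta]. Twisting this state by the square root of the likelihood ratio of the two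
    spectral densities gives a vector that every symmetric tester accepts as often as the rank [r]
    state. The squared distance of the two vectors is a Hellinger distance, that is [2 - 2 * BC] for
    the Bhattacharyya coefficient [BC]. The exponent comes from
    [1/r - 1/(r + Delta) <= Delta / r^2]: the losses add up to the order of [(N * Delta / r^2)^2],
    which reaches a constant at [N] of order [r^2 / Delta]. The obstacle is that the quadratic
    estimate of the square root breaks down when a factor [1 + c_m / r] is small or negative. A
    moment of fixed order [2k] controls this event at a cost of order [N^(k+1) / r^(2k)], which is
    small for [N <= c * r^(2 - eps)] once [k] is large in terms of [eps]; this is the source of the
    [r^(o(1))] loss. Invariance, positivity and support of kernels are phrased as commutation
    relations or as Gram sums, so that they survive the square roots and quotients taken in the
    joint spectrum. *)

Lemma card_ord_lt (d s : nat) : (s <= d)%N -> #|[pred c : 'I_d | (c < s)%N]| = s.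
Proof. by move=> sd; rewrite -sum1_card (big_ord_narrow sd) /= sum1_card card_ord. Qed.

Section Colorings.
Variables (N d : nat).
Implicit Types (p q : 'S_N) (x y : {ffun 'I_N -> 'I_d}) (s n : nat).

Definition color_bounded s x := [forall k, (x k < s)%N].

Definition color_fixed p x := [forall k, x (p k) == x k].

(* [s ^ cycles(p)]: the trace of [p] permuting the tensor factors of (C^s)^(x)N.
   Colors range over ['I_d] with [s <= d], so that different [s] share a type. *)
Definition fixcount s p := #|[set x | color_bounded s x & color_fixed p x]|.

Definition recolor (m : 'I_N) (c : 'I_d) x : {ffun 'I_N -> 'I_d} :=
  [ffun k => if k == m then c else x k].

Lemma recolor_bounded s m (c : 'I_d) x :
  (c < s)%N -> color_bounded s x -> color_bounded s (recolor m c x).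
Proof.
move=> cs /forallP xs; apply/forallP => k; rewrite ffunE.
by case: ifP.
Qed.

Lemma recolor_fixed p m c x :
  p m = m -> color_fixed p x -> color_fixed p (recolor m c x).
Proof.
move=> pm /forallP xp; apply/forallP => k; rewrite !ffunE.
have -> : (p k == m) = (k == m) by rewrite -{1}pm (inj_eq perm_inj).
by case: ifP => // _; exact: xp.
Qed.

Lemma color_fixed_tperm p i m x :
  p m = m -> color_fixed (p * tperm i m)%g x = color_fixed p x && (x i == x m).
Proof.
move=> pm; apply/forallP/andP => [xp|[/forallP xp /eqP xim] k].
  have xim : x i = x m by have /eqP := xp m; rewrite permM pm tpermR.
  rewrite xim; split=> //; apply/forallP => k; have := xp k.
  by rewrite permM; case: tpermP => // ->; rewrite ?xim // -xim.
rewrite permM; have := xp k; case: tpermP => // ->; by rewrite xim.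
Qed.

(** The fixed point [m] is a cycle of [p] by itself, and [tperm i m] merges it into the cycle of
    [i]. The free choice of a color for [m], worth a factor [s], is lost. *)
Lemma fixcount_tperm s p i m : (s <= d)%N -> i != m -> p m = m ->
  fixcount s p = (s * fixcount s (p * tperm i m)%g)%N.
Proof.
move=> sd im pm; rewrite /fixcount -!sum1_card.
under eq_bigl do rewrite inE.
rewrite (partition_big (fun x => x m) (fun c : 'I_d => (c < s)%N)) /=; last first.
  by move=> x /andP[/forallP xs _]; exact: xs.
transitivity (\sum_(c < d | (c < s)%N)
   \sum_(x in [set x | color_bounded s x & color_fixed (p * tperm i m)%g x]) 1)%N.
  apply: eq_bigr => c cs.
  rewrite (reindex_onto (recolor m c) (fun x => recolor m (x i) x)) /=.
    apply: eq_bigl => x; rewrite inE color_fixed_tperm //; apply/idP/idP.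
      move=> /andP[/andP[/andP[/forallP xs xp] _] /eqP e].
      have xim : x i = x m.
        by have := congr1 (fun y => y m) e; rewrite !ffunE eqxx (negPf im).
      have -> : x = recolor m (x i) (recolor m c x).
        by apply/ffunP => k; rewrite !ffunE; case: eqP => // ->; rewrite xim.
      rewrite andbA; apply/andP; split; last by rewrite !ffunE eqxx (negPf im).
      have xis : (x i < s)%N by have := xs i; rewrite ffunE (negPf im).
      apply/andP; split; last exact: recolor_fixed.
      by apply: recolor_bounded => //; apply/forallP.
    move=> /andP[xs /andP[xp /eqP xim]].
    rewrite recolor_bounded // recolor_fixed // ffunE eqxx eqxx /=.
    by apply/eqP/ffunP => k; rewrite !ffunE (negPf im); case: eqP => // ->; rewrite xim.
  move=> x /andP[_ /eqP xm]; apply/ffunP => k.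
  by rewrite !ffunE; case: eqP => // ->.
by rewrite [LHS]sum_nat_const card_ord_lt.
Qed.

Lemma fixcount1 s : (s <= d)%N -> fixcount s 1%g = (s ^ N)%N.
Proof.
move=> sd; rewrite /fixcount.
transitivity #|[set f : {ffun 'I_N -> 'I_d} in ffun_on [pred c : 'I_d | (c < s)%N]]|.
  apply: eq_card => x; rewrite !inE.
  have -> : color_fixed 1%g x by apply/forallP => k; rewrite perm1.
  rewrite andbT; apply/forallP/ffun_onP => h k; exact: h.
rewrite cardsE card_ffun_on card_ord; congr (_ ^ _)%N.
exact: card_ord_lt.
Qed.

Lemma fixcountJ s p q : fixcount s (p ^ q)%g = fixcount s p.
Proof.
rewrite /fixcount -!sum1_card.
pose h (r : 'S_N) x : {ffun 'I_N -> 'I_d} := [ffun k => x (r k)].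
have hK r : cancel (h r) (h r^-1%g).
  by move=> x; apply/ffunP => k; rewrite !ffunE permKV.
rewrite [LHS](reindex (h q^-1%g)) /=; last first.
  exists (h q) => x _; last exact: hK.
  by rewrite -{1}[q]invgK hK.
apply: eq_bigl => x; rewrite !inE; congr andb.
  apply/forallP/forallP => xs k; last by rewrite ffunE.
  by have := xs (q k); rewrite ffunE permK.
apply/forallP/forallP => xp k.
  have := xp (q k); rewrite !ffunE /conjg !permM !permK; by [].
rewrite !ffunE /conjg !permM permK; exact: xp.
Qed.

Definition fixes_above n p := [forall k : 'I_N, (n <= k)%N ==> (p k == k)].

Lemma fixes_aboveP n p :
  reflect (forall k : 'I_N, (n <= k)%N -> p k = k) (fixes_above n p).
Proof.
apply: (iffP forallP) => h k; first by move=> nk; apply/eqP; apply: (implyP (h k)).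
by apply/implyP => nk; apply/eqP; exact: h.
Qed.

Lemma fixes_above1 n : fixes_above n 1%g.
Proof. by apply/fixes_aboveP => k _; rewrite perm1. Qed.

Lemma fixes_aboveN p : fixes_above N p.
Proof. by apply/fixes_aboveP => k; rewrite leqNgt ltn_ord. Qed.

Lemma fixes_aboveM n p q : fixes_above n p -> fixes_above n q -> fixes_above n (p * q)%g.
Proof. by move=> /fixes_aboveP hp /fixes_aboveP hq; apply/fixes_aboveP => k nk;
  rewrite permM hp ?hq. Qed.

Lemma fixes_aboveV n p : fixes_above n p^-1%g = fixes_above n p.
Proof.
suff h q : fixes_above n q -> fixes_above n q^-1%g.
  by apply/idP/idP => /h //; rewrite invgK.
by move=> /fixes_aboveP hq; apply/fixes_aboveP => k nk; rewrite -{1}(hq k nk) permK.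
Qed.

Lemma fixes_aboveS n p (m : 'I_N) : m = n :> nat ->
  fixes_above n p = fixes_above n.+1 p && (p m == m).
Proof.
move=> mn; apply/fixes_aboveP/andP => [h|[/fixes_aboveP h /eqP pm] k].
  split; last by rewrite h ?mn.
  by apply/fixes_aboveP => k /ltnW; exact: h.
rewrite leq_eqVlt => /predU1P[nk|]; last exact: h.
by rewrite (_ : k = m) //; apply: val_inj; rewrite /= mn.
Qed.

Lemma fixes_above_tperm n (i m : 'I_N) : (i < n)%N -> (m < n)%N -> fixes_above n (tperm i m).
Proof.
move=> im mn; apply/fixes_aboveP => k nk; rewrite tpermD //.
  by apply: contraL nk => /eqP <-; rewrite -ltnNge.
by apply: contraL nk => /eqP <-; rewrite -ltnNge.
Qed.

Variable R : numFieldType.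

(* The normalized trace of [p] on (C^s)^(x)N, cut off to the permutations of the
   first [n] points. *)
Definition perm_trace n s p : R :=
  if fixes_above n p then (fixcount s p)%:R / (s ^ N)%:R else 0.

Lemma perm_trace1 n s : (0 < s <= d)%N -> perm_trace n s 1%g = 1.
Proof.
move=> /andP[s0 sd]; rewrite /perm_trace fixes_above1 fixcount1 // divff //.
by rewrite pnatr_eq0 -lt0n expn_gt0 s0.
Qed.

(* Coefficientwise form of [sum_p s^(-|p|) p = prod_m (1 + J_m / s)]. *)
Lemma perm_trace_jucys_murphy (m : 'I_N) s p : (0 < s <= d)%N ->
  perm_trace m.+1 s p =
    perm_trace m s p + s%:R^-1 * \sum_(i : 'I_N | (i < m)%N) perm_trace m s (p * tperm i m)%g.
Proof.
move=> /andP[s0 sd].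
have sR : s%:R != 0 :> R by rewrite pnatr_eq0 -lt0n.
(* Only [i = p m] can make [p * tperm i m] fix [m], so at most one term of the sum survives. *)
have noti (i : 'I_N) : (i < m)%N -> p m != i -> perm_trace m s (p * tperm i m)%g = 0.
  move=> im pmi; rewrite /perm_trace; case: ifP => // /fixes_aboveP /(_ m (leqnn _)).
  rewrite permM; case: tpermP => [e|e|].
  - by rewrite e eqxx in pmi.
  - by move=> e'; rewrite -e' ltnn in im.
  - by move=> _ h1 h2; rewrite h2 in h1.
case: (eqVneq (p m) m) => [pm|pm].
  rewrite big1 ?mulr0 ?addr0; last first.
    by move=> i im; apply: noti => //; rewrite pm; apply: contraL im => /eqP ->; rewrite ltnn.
  by rewrite /perm_trace (fixes_aboveS _ (erefl (m : nat))) pm eqxx andbT.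
have -> : perm_trace m s p = 0 by rewrite /perm_trace (fixes_aboveS _ (erefl (m : nat))) (negPf
  pm) andbF.
rewrite add0r.
case: (boolP (fixes_above m.+1 p)) => hp; last first.
  rewrite big1 ?mulr0; first by rewrite /perm_trace (negPf hp).
  move=> i im; rewrite /perm_trace; case: ifP => // /fixes_aboveP h; case/negP: hp.
  rewrite -(mulgK (tperm i m) p) tpermV; apply: fixes_aboveM.
    by apply/fixes_aboveP => k /ltnW; exact: h.
  by apply: fixes_above_tperm; rewrite // ltnW.
have pmm : (p m < m)%N.
  rewrite ltnNge leq_eqVlt; apply/negP => /predU1P[e|h].
    by case/eqP: pm; apply/val_inj.
  have := perm_inj (fixes_aboveP _ _ hp _ h) => e; by rewrite e eqxx in pm.
rewrite (bigD1 (p m)) //= big1 ?addr0; last first.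
  by move=> i /andP[im ne]; apply: noti => //; rewrite eq_sym.
set q := (p * tperm (p m) m)%g.
have qm : q m = m by rewrite permM tpermL.
have hq : fixes_above m q.
  rewrite (fixes_aboveS _ (erefl (m : nat))) qm eqxx andbT fixes_aboveM //.
  by apply: fixes_above_tperm => //; rewrite ltnW.
have pq : p = (q * tperm (p m) m)%g by rewrite -mulgA tperm2 mulg1.
rewrite /perm_trace hp hq (@fixcount_tperm s q (p m) m) // -pq natrM.
by rewrite -mulrA mulKf.
Qed.

End Colorings.

(** * Words in star transpositions *)

Section Words.
Variables (N d : nat) (m : 'I_N).
Implicit Types (w : seq 'I_N) (s k L : nat).

(** A power of [J_m] expands into products of star transpositions [tperm i m]; each product is
    recorded by its word of letters [i]. *)
Definition word_perm w : 'S_N := foldr (fun i p => (tperm i m * p)%g) 1%g w.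

Definition singletons w := [pred i : 'I_N | count_mem i w == 1%N].

Lemma word_perm_letter w : word_perm w m \in m :: w.
Proof.
suff h (i : 'I_N) : word_perm w i \in [:: i, m & w].
  by have := h m; rewrite !inE orbA orbb.
elim: w i => [|j w IH] i /=; first by rewrite perm1 inE eqxx.
rewrite permM; case: tpermP => _; have := IH _.
- by move/(_ m); rewrite !inE orbA orbb => /orP[->|->]; rewrite ?orbT.
- by move/(_ j); rewrite !inE => /or3P[] ->; rewrite ?orbT.
- by move/(_ i); rewrite !inE => /or3P[] ->; rewrite ?orbT.
Qed.

(* A letter occurring once is sent by [word_perm w] to [m] or to a later
   letter, so an invariant coloring is determined off the singletons. *)
Lemma color_fixed_singletons w (x y : {ffun 'I_N -> 'I_d}) :
  m \notin w -> color_fixed (word_perm w) x -> color_fixed (word_perm w) y ->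
  (forall i, i \notin singletons w -> x i = y i) -> x = y.
Proof.
move=> mw /forallP xw /forallP yw xy.
suff h w1 w2 : w = w1 ++ w2 -> forall i, i \in m :: w2 -> x i = y i.
  apply/ffunP => i; case: (boolP (i \in w)) => iw.
    by apply: (h [::] w erefl); rewrite inE iw orbT.
  by apply: xy; rewrite inE (count_memPn iw).
have xm : x m = y m by apply: xy; rewrite inE (count_memPn mw).
elim: w2 w1 => [|j w2 IH] w1 e i.
  by rewrite inE => /eqP ->.
have {}IH : forall i, i \in m :: w2 -> x i = y i.
  by apply: (IH (rcons w1 j)); rewrite cat_rcons.
rewrite !inE => /or3P[/eqP -> //|/eqP ->|iw2]; last by apply: IH; rewrite inE iw2 orbT.
case: (boolP (j \in singletons w)) => [|/xy //].
rewrite inE e count_cat /= eqxx => jw.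
have jw1 : j \notin w1 by apply/count_memPn; move: jw; case: (count_mem j w1) => //; lia.
have jucys_murphy : j != m by apply: contraNneq mw => <-; rewrite e mem_cat inE eqxx orbT.
have wj : word_perm w j = word_perm w2 m.
  rewrite e; elim: (w1) jw1 => [_|l w1' IH'] /=.
    by rewrite permM tpermL.
  rewrite inE negb_or => /andP[jl jw1'].
  by rewrite permM tpermD 1?eq_sym // IH'.
rewrite -(eqP (xw j)) -(eqP (yw j)) wj; apply: IH; exact: word_perm_letter.
Qed.

(** In normalized form, each letter of multiplicity one gains a factor [1 / s] in the trace. *)
Lemma fixcount_word w s : m \notin w -> (s <= d)%N ->
  (fixcount d s (word_perm w) * s ^ #|singletons w| <= s ^ N)%N.
Proof.
move=> mw sd.
case: (posnP (fixcount d s (word_perm w))) => [->|]; first by rewrite mul0n.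
rewrite /fixcount => /card_gt0P[x0 _].
(* Overwriting the singletons by a constant color is injective on fixed colorings, by
   [color_fixed_singletons]; [x0] only supplies that color. *)
pose h (x : {ffun 'I_N -> 'I_d}) : {ffun 'I_N -> 'I_d} :=
  [ffun k => if k \in singletons w then x0 m else x k].
have : (fixcount d s (word_perm w) <= s ^ #|predC (singletons w)|)%N.
  rewrite -[s in (s ^ _)%N](card_ord_lt sd) -(card_pffun_on (x0 m)) /fixcount.
  rewrite -(@card_in_imset _ _ h); last first.
    move=> x y; rewrite !inE => /andP[_ xw] /andP[_ yw] e.
    apply: (color_fixed_singletons mw xw yw) => i iw.
    by have := congr1 (fun f : {ffun 'I_N -> 'I_d} => f i) e; rewrite !ffunE (negPf iw).
  apply/subset_leq_card/subsetP => _ /imsetP[x + ->].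
  rewrite inE => /andP[/forallP xs _].
  apply/pffun_onP; split.
    apply/subsetP => i; rewrite !inE ffunE inE.
    by case: (count_mem i w == 1%N) => //; rewrite eqxx.
  move=> _ /imageP[i iw ->]; rewrite ffunE; move: iw; rewrite !inE.
  by move/negPf ->; exact: xs.
move=> h1; apply: leq_trans (leq_mul h1 (leqnn _)) _.
by rewrite -expnD addnC cardC card_ord.
Qed.

(** A letter of multiplicity [c >= 1] satisfies [2 <= c + (c == 1)]; sum over the letters. *)
Lemma singletons_undup w : (2 * size (undup w) <= size w + #|singletons w|)%N.
Proof.
have sub : (#|singletons w| = \sum_(i <- undup w) (count_mem i w == 1))%N.
  transitivity (\sum_(i : 'I_N) (count_mem i w == 1%N))%N.
    by rewrite -sum1_card big_mkcond /=; apply: eq_bigr => i _; rewrite inE; case: ifP.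
  rewrite (bigID (fun i => i \in w)) /= [X in (_ + X)%N]big1 ?addn0; last first.
    by move=> i iw; rewrite (count_memPn iw).
  rewrite [RHS]big_uniq ?undup_uniq //=.
  by apply: eq_bigl => i; rewrite mem_undup.
have sz : (size w = \sum_(i <- undup w) count_mem i w)%N.
  rewrite [RHS]big_uniq ?undup_uniq //=.
  have -> : size w = (\sum_(i : 'I_N) count_mem i w)%N.
    elim: w {sub} => [|j w IH] /=; first by rewrite big1.
    rewrite big_split /= -IH (bigD1 j) //= eqxx big1 ?addn0 ?add1n //.
    by move=> i ij; rewrite eq_sym (negPf ij).
  rewrite (bigID (fun i => i \in w)) /= [X in (_ + X)%N]big1 ?addn0; last first.
    by move=> i iw; rewrite (count_memPn iw).
  by apply: eq_bigl => i; rewrite mem_undup.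
rewrite sub [X in (_ <= X + _)%N]sz -big_split /= -sum1_size big_distrr /=.
rewrite big_seq [leqRHS]big_seq leq_sum // => i.
rewrite mem_undup -has_pred1 has_count; case: (count_mem i w) => [|[|c]] //=; lia.
Qed.

(** Each distinct letter beyond [k] costs a factor [n] and forces two more singletons, which pay
    [s ^ 2 >= n]. *)
Lemma expn_letters (n s k D a : nat) : (0 < n)%N -> (0 < s)%N -> (n <= s ^ 2)%N ->
  (2 * D <= 2 * k + a)%N -> (n ^ D <= n ^ k * s ^ a)%N.
Proof.
move=> n0 s0 ns Da; case: (leqP D k) => [Dk|kD].
  by rewrite (leq_trans (leq_pexp2l n0 Dk)) // leq_pmulr // expn_gt0 s0.
rewrite -(subnK (ltnW kD)) expnD mulnC leq_mul2l; apply/orP; right.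
have h : (n ^ (D - k) <= (s ^ 2) ^ (D - k))%N by rewrite leq_exp2r // subn_gt0.
by apply: leq_trans h _; rewrite -expnM leq_pexp2l //; lia.
Qed.

Variable R : numFieldType.
Implicit Types F G : seq 'I_N -> R.

Fixpoint wsum L F : R :=
  if L is L'.+1 then \sum_(i : 'I_N | (i < m)%N) wsum L' (fun w => F (i :: w)) else F [::].

Lemma wsum_le L F G :
  (forall w, size w = L -> all (fun i : 'I_N => (i < m)%N) w -> F w <= G w) ->
  wsum L F <= wsum L G.
Proof.
elim: L F G => [|L IH] F G FG /=; first exact: FG.
by apply: ler_sum => i im; apply: IH => w wL wm; apply: FG => //=; rewrite ?wL ?im.
Qed.

Lemma eq_wsum L F G : F =1 G -> wsum L F = wsum L G.
Proof.
elim: L F G => [|L IH] F G FG /=; first exact: FG.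
by apply: eq_bigr => i _; apply: IH => w; exact: FG.
Qed.

Lemma wsum_sum L (P : pred 'I_N) (F : 'I_N -> seq 'I_N -> R) :
  wsum L (fun w => \sum_(i | P i) F i w) = \sum_(i | P i) wsum L (F i).
Proof.
elim: L F => //= L IH F.
by under eq_bigr do rewrite IH; rewrite exchange_big.
Qed.

Lemma wsumZ L (c : R) F : wsum L (fun w => c * F w) = c * wsum L F.
Proof. by elim: L F => //= L IH F; under eq_bigr do rewrite IH; rewrite mulr_sumr. Qed.

(** Induction on the length: a prepended letter is either one of at most [L] old ones and keeps the
    weight, or one of at most [m] new ones and divides it by [m]. Together this is a factor
    [L + 1]. *)
Lemma wsum_distinct L :
  wsum L (fun w => ((m : nat)%:R ^+ size (undup w))^-1) <= L`!%:R.
Proof.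
elim: L => [|L IH]; first by rewrite /= expr0 invr1.
have -> : wsum L.+1 (fun w => ((m : nat)%:R ^+ size (undup w))^-1) =
    wsum L (fun w => \sum_(i : 'I_N |
      (i < m)%N) (((m : nat)%:R : R) ^+ size (undup (i :: w)))^-1).
  by rewrite wsum_sum.
apply: le_trans (_ : _ <= L.+1%:R * wsum L (fun w => ((m : nat)%:R ^+ size (undup w))^-1)) _;
  last first.
  by rewrite factS natrM ler_wpM2l.
rewrite -wsumZ; apply: wsum_le => w wL _.
set q := (m : nat)%:R : R.
set t := (q ^+ size (undup w))^-1.
have t0 : 0 <= t by rewrite invr_ge0 exprn_ge0 // ler0n.
apply: le_trans (_ : _ <= \sum_(i : 'I_N | (i < m)%N) ((i \in w)%:R * t + q^-1 * t)) _.
  apply: ler_sum => i im /=; case: (i \in w).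
    by rewrite mul1r lerDl mulr_ge0 // invr_ge0 ler0n.
  by rewrite /= mul0r add0r exprS invfM.
rewrite big_split /= -!mulr_suml -mulrDl ler_wpM2r // -natr1 lerD //.
  rewrite -natr_sum ler_nat -wL.
  apply: leq_trans (_ : \sum_(i : 'I_N) (i \in w) <= _)%N.
    by rewrite [leqRHS](bigID (fun i : 'I_N => (i < m)%N)) leq_addr.
  have -> : (\sum_(i : 'I_N) (i \in w) = #|w|)%N.
    by rewrite -sum1_card [RHS]big_mkcond; apply: eq_bigr => i _; case: ifP.
  exact: card_size.
rewrite sumr_const -[_ *+ _]mulr_natl.
have -> : #|[pred i : 'I_N | (i < m)%N]| = m by apply: card_ord_lt; exact: ltnW.
have [m0|m0] := posnP m; first by rewrite m0 mul0r.
by rewrite -/q divff // pnatr_eq0 -lt0n.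
Qed.

(** Bounds the moment of order [2k] of [J_m] at rank [s] by the order [m ^ k] expected of a variable
    of variance [m]. A word with [D] distinct letters has trace at most [m ^ (k - D)], and
    [wsum_distinct] sums these weights. *)
Lemma wsum_perm_trace k s : (0 < s <= d)%N -> (m <= s ^ 2)%N ->
  wsum (2 * k) (fun w => perm_trace d R m s (word_perm w)) <=
    (2 * k)`!%:R * (m : nat)%:R ^+ k.
Proof.
move=> /andP[s0 sd] ms.
apply: le_trans (_ : _ <= wsum (2 * k) (fun w =>
  (m : nat)%:R ^+ k * ((m : nat)%:R ^+ size (undup w))^-1)) _; last first.
  by rewrite wsumZ mulrC ler_wpM2r ?exprn_ge0 ?ler0n // wsum_distinct.
apply: wsum_le => w wk wm.
have mw : m \notin w.
  by apply/negP => /(allP wm); rewrite ltnn.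
have nD : ((m : nat) ^ size (undup w) > 0)%N.
  rewrite expn_gt0; case: posnP => //= m0.
  by case: (w) wm => //= i w'; rewrite m0.
rewrite /perm_trace; case: ifP => _; last by rewrite mulr_ge0 ?invr_ge0 ?exprn_ge0 ?ler0n.
rewrite -!natrX ler_pdivrMr ?ltr0n ?expn_gt0 ?s0 // mulrAC ler_pdivlMr ?ltr0n //.
rewrite -!natrM ler_nat.
have [m0|m0] := posnP (m : nat).
  have -> : w = [::] by case: (w) wm => //= i w'; rewrite m0.
  rewrite /= expn0 muln1 m0.
  have k0 : k = 0%N by move: wk; case: (w) wm => [|i w'] /=; [lia|rewrite m0].
  by rewrite k0 expn0 mul1n fixcount1.
have := fixcount_word mw sd.
have := expn_letters m0 s0 ms (k := k) (D := size (undup w)) (a := #|singletons w|).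
rewrite -wk => /(_ (singletons_undup w)) h1 h2.
apply: leq_trans (leq_mul (leqnn _) h1) _.
by rewrite mulnCA leq_mul2l h2 orbT.
Qed.

End Words.

(** * Functional calculus of commuting Hermitian matrices *)

Local Open Scope sesquilinear_scope.

Lemma sum_enum_val (V : nmodType) (T : finType) (F : T -> V) :
  \sum_(i < #|T|) F (enum_val i) = \sum_x F x.
Proof. by rewrite -(big_enum_val (A := T) F). Qed.

Lemma adjmxM (C : numClosedFieldType) m n p (A : 'M[C]_(m, n)) (B : 'M_(n, p)) :
  (A *m B)^t* = B^t* *m A^t*.
Proof. by rewrite trmx_mul map_mxM. Qed.

(** A simultaneous unitary triangularization suffices, since a Hermitian triangular matrix is
    diagonal. *)
Lemma commuting_hermitian_diag (C : numClosedFieldType) n (As : seq 'M[C]_n) :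
  {in As &, forall A B, comm_mx A B} -> {in As, forall A, A^t* = A} ->
  exists2 P : 'M[C]_n, P \is unitarymx &
    {in As, forall A, is_diag_mx (P *m A *m P^t*)}.
Proof.
move=> Acomm Aherm.
have [P Pu /allP Ptrig] := cotrigonalization Acomm.
exists P => // A AAs; have := Ptrig A AAs.
rewrite /= /similar_to /= conjymx // => /is_trig_mxP tr.
apply/is_diag_mxP => i j; rewrite neq_ltn => /orP[|] ij; first exact: tr.
have h : (P *m A *m P^t*)^t* = P *m A *m P^t*.
  by rewrite !adjmxM trmxCK (Aherm A) // mulmxA.
by rewrite -h [LHS]mxE [X in X^*]mxE tr ?conjC0.
Qed.

Lemma unitary_conjmxK (C : numClosedFieldType) n (P A : 'M[C]_n) :
  P \is unitarymx -> P^t* *m (P *m A *m P^t*) *m P = A.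
Proof.
move=> Pu; have PtP : P^t* *m P = 1%:M by rewrite -(mul1mx (P^t*)) mulmxKtV.
by rewrite !mulmxA PtP mul1mx -mulmxA PtP mulmx1.
Qed.

Section FunctionalCalculus.
Variables (R : rcfType) (g : nat) (P : 'M[R[i]]_g).
Hypothesis Pu : P \is unitarymx.
Local Notation toC := (real_complex R).

(** The argument of [f] indexes a joint eigenvector, so functions of several commuting matrices are
    covered at once. *)
Definition funmx (f : 'I_g -> R) : 'M[R[i]]_g :=
  P^t* *m diag_mx (\row_i toC (f i)) *m P.

Let PtP : P^t* *m P = 1%:M.
Proof. by rewrite -(mul1mx (P^t*)) mulmxKtV. Qed.

Let PPt : P *m P^t* = 1%:M.
Proof. exact/unitarymxP. Qed.

Lemma conj_toC (x : R) : (toC x)^* = toC x.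
Proof. by apply/CrealP/complex_realP; exists x. Qed.

Lemma eq_funmx f h : f =1 h -> funmx f = funmx h.
Proof.
move=> fh; apply: (congr1 (fun X => P^t* *m X *m P)).
by apply/matrixP => i j; rewrite !mxE fh.
Qed.

Let sandwichM (X Y : 'M[R[i]]_g) :
  (P^t* *m X *m P) *m (P^t* *m Y *m P) = P^t* *m (X *m Y) *m P.
Proof. by rewrite !mulmxA mulmxtVK // -!mulmxA. Qed.

Lemma funmxM f h : funmx f *m funmx h = funmx (fun i => f i * h i).
Proof.
rewrite /funmx sandwichM mulmx_diag.
apply: (congr1 (fun X => P^t* *m X *m P)).
apply/matrixP => i j.
rewrite !mxE.
by rewrite (rmorphM toC).
Qed.

Lemma funmx1 : funmx (fun=> 1) = 1%:M.
Proof.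
rewrite /funmx (_ : diag_mx _ = 1%:M) ?mulmx1 //.
by apply/matrixP => i j; rewrite !mxE rmorph1.
Qed.

Lemma funmxZD (a : R) f h : funmx (fun i => f i + a * h i) = funmx f + toC a *: funmx h.
Proof.
rewrite /funmx scalemxAl scalemxAr -mulmxDl -mulmxDr.
apply: (congr1 (fun X => P^t* *m X *m P)); apply/matrixP => i j; rewrite !mxE.
by rewrite rmorphD rmorphM mulrnDl mulrnAr.
Qed.

Lemma funmx_herm f : (funmx f)^t* = funmx f.
Proof.
have h (X : 'M[R[i]]_g) : (P^t* *m X *m P)^t* = P^t* *m X^t* *m P.
  by rewrite !adjmxM trmxCK mulmxA.
apply: etrans (h _) _; apply: (congr1 (fun X => P^t* *m X *m P)).
apply/matrixP => i j; rewrite !mxE eq_sym; case: eqP => [->|]; last by rewrite rmorph0.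
by rewrite !mulr1n; exact: conj_toC.
Qed.

Lemma mxtrace_funmx f : \tr (funmx f) = toC (\sum_i f i).
Proof.
rewrite /funmx mxtrace_mulC mulmxA PPt mul1mx mxtrace_diag rmorph_sum.
by apply: eq_bigr => i _; rewrite mxE.
Qed.

Lemma funmxK f i : (P *m funmx f *m P^t*) i i = toC (f i).
Proof.
have h (X : 'M[R[i]]_g) : P *m (P^t* *m X *m P) *m P^t* = X.
  by rewrite !mulmxA PPt mul1mx -mulmxA PPt mulmx1.
by apply: etrans (congr1 (fun M : 'M_g => M i i) (h _)) _; rewrite !mxE eqxx mulr1n.
Qed.

(** In the eigenbasis, commuting with [f] means that the entry [(i, j)] vanishes unless [f i = f j],
    and this is inherited by [phi \o f]. Invariance thus passes to square roots and inverses. *)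
Lemma funmx_comm_comp f (phi : R -> R) (A : 'M[R[i]]_g) :
  A *m funmx f = funmx f *m A ->
  A *m funmx (fun i => phi (f i)) = funmx (fun i => phi (f i)) *m A.
Proof.
have [B ->] : exists B, A = P^t* *m B *m P.
  by exists (P *m A *m P^t*); rewrite !mulmxA PtP mul1mx -mulmxA PtP mulmx1.
have cancelP X : P *m (P^t* *m X *m P) *m P^t* = X.
  by rewrite !mulmxA PPt mul1mx -mulmxA PPt mulmx1.
pose D (h : 'I_g -> R) := diag_mx (\row_i toC (h i)).
have BD h : (P^t* *m B *m P) *m funmx h = P^t* *m (B *m D h) *m P := sandwichM B (D h).
have DB h : funmx h *m (P^t* *m B *m P) = P^t* *m (D h *m B) *m P := sandwichM (D h) B.
move=> Bf; have {}Bf := etrans (esym (BD f)) (etrans Bf (DB f)).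
have {Bf} B0 : B *m D f = D f *m B.
  exact: etrans (esym (cancelP _)) (etrans (congr1 (fun M => P *m M *m P^t*) Bf) (cancelP _)).
apply: etrans (BD _) (etrans _ (esym (DB _))).
apply: (congr1 (fun X => P^t* *m X *m P)).
apply/matrixP => i j; have := congr1 (fun M : 'M_g => M i j) B0.
rewrite !mul_mx_diag !mul_diag_mx !mxE.
case: (eqVneq (f i) (f j)) => [-> _|ne]; first by rewrite mulrC.
move/eqP; rewrite mulrC -subr_eq0 -mulrBl mulf_eq0 subr_eq0 => /orP[/eqP/complexI e|/eqP ->].
  by rewrite e eqxx in ne.
by rewrite mul0r mulr0.
Qed.

End FunctionalCalculus.

(** * Jucys-Murphy elements in the regular representation *)

Section Kernels.
Variables (R : rcfType) (N d : nat).
Local Notation C := R[i].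
Local Notation toC := (real_complex R).
Local Notation g := #|{: 'S_N}|.
Implicit Types (p q : 'S_N) (f h : 'S_N -> C) (m : 'I_N) (s n : nat).

(* Convolution by [f] in the regular representation. *)
Definition conv_mx f : 'M[C]_g := \matrix_(i, j) f ((enum_val i)^-1 * enum_val j)%g.

Definition entry (A : 'M[C]_g) p q : C := A (enum_rank p) (enum_rank q).

Lemma entry_conv_mx f p q : entry (conv_mx f) p q = f (p^-1 * q)%g.
Proof. by rewrite /entry mxE !enum_rankK. Qed.

Lemma entryP (A B : 'M[C]_g) : (forall p q, entry A p q = entry B p q) -> A = B.
Proof.
by move=> AB; apply/matrixP => i j; have := AB (enum_val i) (enum_val j);
  rewrite /entry !enum_valK.
Qed.

Lemma entryM (A B : 'M[C]_g) p q : entry (A *m B) p q = \sum_r entry A p r * entry B r q.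
Proof.
rewrite /entry mxE -(sum_enum_val (fun r =>
  A (enum_rank p) (enum_rank r) * B (enum_rank r) (enum_rank q))).
by apply: eq_bigr => i _; rewrite enum_valK.
Qed.

Lemma entry1 p q : entry 1%:M p q = (p == q)%:R.
Proof. by rewrite /entry mxE (inj_eq enum_rank_inj). Qed.

Lemma eq_conv_mx f h : f =1 h -> conv_mx f = conv_mx h.
Proof. by move=> fh; apply/matrixP => i j; rewrite !mxE fh. Qed.

Lemma conv_mxM f h : conv_mx f *m conv_mx h = conv_mx (fun p => \sum_q f q * h (q^-1 * p)%g).
Proof.
apply: entryP => p q; rewrite entryM entry_conv_mx.
rewrite (reindex_inj (mulgI p)) /=; apply: eq_bigr => r _.
by rewrite !entry_conv_mx mulKg invMg mulgA.
Qed.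

Lemma conv_mx_herm f : (forall p, f p^-1%g = (f p)^*) -> (conv_mx f)^t* = conv_mx f.
Proof.
move=> fV; apply/matrixP => i j; rewrite !mxE -fV.
by rewrite invMg invgK.
Qed.

Lemma mxtrace_conv_mx f : \tr (conv_mx f) = g%:R * f 1%g.
Proof.
rewrite /mxtrace; under eq_bigr do rewrite mxE mulVg.
by rewrite sumr_const card_ord mulr_natl.
Qed.

(* The Jucys-Murphy element [J_m], the sum of the [tperm i m] with [i < m]. *)
Definition jucys_murphy m p : C := \sum_(i : 'I_N | (i < m)%N) (p == tperm i m)%:R.

Lemma conv_mx_jucys_murphy f m :
  conv_mx f *m conv_mx (jucys_murphy m) =
    conv_mx (fun p => \sum_(i : 'I_N | (i < m)%N) f (p * tperm i m)%g).
Proof.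
rewrite conv_mxM; apply: eq_conv_mx => p.
under eq_bigr do rewrite /jucys_murphy mulr_sumr.
rewrite exchange_big /=; apply: eq_bigr => i im.
rewrite (bigD1 (p * tperm i m)%g) //= big1 ?addr0; last first.
  move=> q qp; rewrite (_ : _ == _ = false) ?mulr0 //.
  apply: contraNF qp => /eqP e; apply/eqP.
  by rewrite -tpermV -e invMg invgK mulKVg.
by rewrite invMg tpermV mulgKV eqxx mulr1.
Qed.

Lemma conv_mx_jucys_murphy_word f m L :
  iter L (fun A => A *m conv_mx (jucys_murphy m)) (conv_mx f) =
    conv_mx (fun p => wsum m L (fun w => f (p * word_perm m w)%g)).
Proof.
elim: L => [|L IH] /=; first by apply: eq_conv_mx => p; rewrite /= mulg1.
rewrite IH conv_mx_jucys_murphy; apply: eq_conv_mx => p /=.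
by apply: eq_bigr => i _; apply: eq_wsum => w; rewrite mulgA.
Qed.

Lemma jucys_murphyJ m p q : fixes_above m p -> jucys_murphy m (q ^ p)%g = jucys_murphy m q.
Proof.
move=> hp; have pm : p m = m by apply: (fixes_aboveP _ _ hp).
have hi (i : 'I_N) : (p i < m)%N = (i < m)%N.
  rewrite !ltnNge; congr negb; apply/idP/idP => h; last by rewrite (fixes_aboveP _ _ hp).
  by have := perm_inj (fixes_aboveP _ _ hp _ h) => <-.
rewrite /jucys_murphy (reindex_inj (@perm_inj _ p)) /=.
apply: eq_big => i; first exact: hi.
by move=> _; rewrite -[in tperm _ _]pm -tpermJ (inj_eq (@conjg_inj _ p)).
Qed.

(** Conjugation by a permutation of the first [m] points only permutes the transpositions in
    [J_m]. *)
Lemma conv_mx_jucys_murphy_comm f m : (forall p, ~~ fixes_above m p -> f p = 0) ->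
  conv_mx f *m conv_mx (jucys_murphy m) = conv_mx (jucys_murphy m) *m conv_mx f.
Proof.
move=> f0; rewrite !conv_mxM; apply: eq_conv_mx => p.
rewrite [RHS](reindex_inj invg_inj) /= [RHS](reindex_inj (mulIg p^-1)%g) /=.
apply: eq_bigr => q _; rewrite invgK mulgKV invMg invgK [RHS]mulrC.
case: (boolP (fixes_above m q)) => [hq|/f0 ->]; last by rewrite !mul0r.
congr (_ * _); rewrite -(@jucys_murphyJ m q^-1%g) ?fixes_aboveV //.
by rewrite /conjg invgK mulgA mulKVg.
Qed.

Lemma jucys_murphyV m p : jucys_murphy m p^-1%g = jucys_murphy m p.
Proof. by apply: eq_bigr => i _; rewrite -{1}[tperm i m]tpermV (inj_eq invg_inj). Qed.

Lemma jucys_murphy_supp m n p : (m < n)%N -> ~~ fixes_above n p -> jucys_murphy m p = 0.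
Proof.
move=> mn hp; rewrite /jucys_murphy big1 // => i im; case: eqP => // e.
by case/negP: hp; rewrite e fixes_above_tperm // (ltn_trans im).
Qed.

Lemma conj_sum_nat (I : finType) (Q : pred I) (b : I -> bool) :
  (\sum_(i | Q i) (b i)%:R : C)^* = \sum_(i | Q i) (b i)%:R.
Proof. by rewrite -natr_sum conjC_nat. Qed.

Lemma conv_mx_jucys_murphy_herm m : (conv_mx (jucys_murphy m))^t* = conv_mx (jucys_murphy m).
Proof. by apply: conv_mx_herm => p; rewrite jucys_murphyV conj_sum_nat. Qed.

Lemma conv_mx_jucys_murphy_commute m m' : conv_mx (jucys_murphy m) *m conv_mx (jucys_murphy m')
  = conv_mx (jucys_murphy m') *m conv_mx (jucys_murphy m).
Proof.
case: (ltngtP m m') => [mm|mm|/val_inj -> //].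
  by apply: conv_mx_jucys_murphy_comm => p; exact: jucys_murphy_supp.
by apply/esym; apply: conv_mx_jucys_murphy_comm => p; exact: jucys_murphy_supp.
Qed.

(** For fixed [i], the numbers [c m i] are classically the contents of the boxes of a standard Young
    tableau. *)
Lemma jucys_murphy_diag : exists (P : 'M[C]_g) (c : 'I_N -> 'I_g -> R),
  P \is unitarymx /\ forall m, conv_mx (jucys_murphy m) = funmx P (c m).
Proof.
have [||P Pu Pd] := @commuting_hermitian_diag C g [seq conv_mx (jucys_murphy m) | m <- enum 'I_N].
- by move=> _ _ /mapP[m _ ->] /mapP[m' _ ->]; exact: conv_mx_jucys_murphy_commute.
- by move=> _ /mapP[m _ ->]; exact: conv_mx_jucys_murphy_herm.
exists P, (fun m i => complex.Re ((P *m conv_mx (jucys_murphy m) *m P^t*) i i)); split=> // m.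
have /(_ (conv_mx (jucys_murphy m))) := Pd;
  rewrite map_f ?mem_enum // => /(_ isT) /is_diag_mxP dg.
set A := P *m _ *m _ in dg *.
have Ah : A^t* = A by rewrite /A !adjmxM trmxCK conv_mx_jucys_murphy_herm mulmxA.
rewrite -[LHS](unitary_conjmxK _ Pu) -/A.
apply: (congr1 (fun X => P^t* *m X *m P)); apply/matrixP => i j;
  rewrite [RHS]mxE [X in X *+ _]mxE.
case: (eqVneq i j) => [<-|ij]; last by rewrite mulr0n dg.
rewrite mulr1n RRe_real //; apply/CrealP.
by have := congr1 (fun M : 'M_g => M i i) Ah; rewrite !mxE.
Qed.

Definition perm_traceC n s p : C := toC (perm_trace d R n s p).

Lemma conv_mx_perm_traceC0 s : (0 < s <= d)%N -> conv_mx (perm_traceC 0 s) = 1%:M.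
Proof.
move=> sd; apply: entryP => p q; rewrite entry_conv_mx entry1 /perm_traceC.
have -> : (p == q) = (p^-1 * q == 1)%g by rewrite -eq_invg_mul invgK.
case: eqP => [->|ne]; first by rewrite perm_trace1 // rmorph1.
rewrite /perm_trace ifN ?rmorph0 //; apply/negP => /fixes_aboveP h; apply: ne.
by apply/permP => k; rewrite h // perm1.
Qed.

Lemma conv_mx_perm_traceCS m s : (0 < s <= d)%N ->
  conv_mx (perm_traceC m.+1 s) = conv_mx (perm_traceC m s) *m (1%:M +
    toC s%:R^-1 *: conv_mx (jucys_murphy m)).
Proof.
move=> sd; rewrite mulmxDr mulmx1 -scalemxAr conv_mx_jucys_murphy.
apply: entryP => p q; rewrite /entry !mxE /perm_traceC perm_trace_jucys_murphy //.
by rewrite rmorphD rmorphM rmorph_sum.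
Qed.

Lemma conv_mx_perm_traceC_funmx (P : 'M[C]_g) (c : 'I_N -> 'I_g -> R) n s :
  P \is unitarymx -> (forall m, conv_mx (jucys_murphy m) = funmx P (c m)) ->
  (0 < s <= d)%N -> (n <= N)%N ->
  conv_mx (perm_traceC n s) = funmx P (fun i => \prod_(m < N | (m < n)%N) (1 + c m i / s%:R)).
Proof.
move=> Pu Pc sd; elim: n => [|n IH] nN.
  by rewrite conv_mx_perm_traceC0 // -(funmx1 Pu); apply: eq_funmx => i; rewrite big_pred0.
apply: etrans (conv_mx_perm_traceCS (Ordinal nN) sd) _.
have e : 1%:M + toC s%:R^-1 *: conv_mx (jucys_murphy (Ordinal nN)) =
    funmx P (fun i => 1 + s%:R^-1 * c (Ordinal nN) i).
  by rewrite Pc -(funmx1 Pu); exact: esym (funmxZD _ _ _ _).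
apply: etrans (congr1 (mulmx _) e) _.
apply: etrans (congr1 (mulmx^~ _) (IH (ltnW nN))) _.
apply: etrans (funmxM Pu _ _) _; apply: eq_funmx => i.
rewrite [RHS](bigD1 (Ordinal nN)) //= mulrC [X in 1 + X]mulrC; congr (_ * _).
apply: eq_bigl => m; rewrite ltnS -val_eqE /= ltn_neqAle andbC.
by [].
Qed.

(** The label separates the left cosets of the group of permutations of the first [n] points that
    preserve [x]. *)
Definition coset_label n (x : {ffun 'I_N -> 'I_d}) p :
    {ffun 'I_N -> 'I_d} * {ffun 'I_N -> option 'I_N} :=
  ([ffun k => x (p k)], [ffun k : 'I_N => if (n <= k)%N then Some (p^-1%g k) else None]).

Lemma coset_labelE n x p q :
  (coset_label n x p == coset_label n x q) =
    fixes_above n (p^-1 * q)%g && color_fixed (p^-1 * q)%g x.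
Proof.
rewrite xpair_eqE andbC; congr andb.
  apply/eqP/fixes_aboveP => [e k nk|h].
    have := congr1 (fun f : {ffun 'I_N -> option 'I_N} => f k) e.
    by rewrite !ffunE nk permM => -[->]; rewrite permKV.
  apply/ffunP => k; rewrite !ffunE; case: ifP => // /h e; congr Some.
  by rewrite -{2}e permM permK.
apply/eqP/forallP => [e k|h].
  have := congr1 (fun f : {ffun 'I_N -> 'I_d} => f (p^-1%g k)) e.
  by rewrite !ffunE permKV permM => ->.
by apply/ffunP => k; rewrite !ffunE; have := h (p k); rewrite permM permK => /eqP.
Qed.

(** The kernel is an average over colorings [x] of the kernels testing equality of labels. Each of
    these is a Gram kernel, which yields positivity; the sum over [x] also grows with [s]. *)
Lemma perm_traceC_qform n s (v : 'S_N -> C) :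
  \sum_p \sum_q v p * perm_traceC n s (p^-1 * q)%g * (v q)^* =
  (s ^ N)%:R^-1 * \sum_(x | color_bounded s x) \sum_z
     `|\sum_p (coset_label n x p == z)%:R * v p| ^+ 2.
Proof.
have kE p : perm_traceC n s p =
    (s ^ N)%:R^-1 * \sum_(x : {ffun 'I_N ->
      'I_d} | color_bounded s x) (fixes_above n p && color_fixed p x)%:R.
  rewrite /perm_traceC /perm_trace; case: (fixes_above n p) => /=;
    last by rewrite rmorph0 big1 ?mulr0.
  rewrite rmorphM /= fmorphV !rmorph_nat mulrC; congr (_ * _).
  rewrite /fixcount -sum1_card natr_sum big_mkcond [RHS]big_mkcond.
  by apply: eq_bigr => x _; rewrite inE; case: color_bounded; case: color_fixed.
rewrite mulr_sumr.
under eq_bigr => p _ do under eq_bigr => q _ do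
  rewrite kE mulrCA -mulrA mulr_sumr mulr_suml mulr_sumr.
under eq_bigr => p _ do rewrite exchange_big /=.
rewrite exchange_big /=; apply: eq_bigr => x xs.
under [in RHS]eq_bigr => z _ do rewrite normCK rmorph_sum mulr_suml.
under eq_bigr => p _ do rewrite -mulr_sumr.
rewrite -mulr_sumr; congr (_ * _).
rewrite [RHS]exchange_big /=; apply: eq_bigr => p _.
under [in RHS]eq_bigr => z _ do rewrite mulr_sumr.
rewrite [RHS]exchange_big /=; apply: eq_bigr => q _.
rewrite (bigD1 (coset_label n x p)) //= big1 ?addr0; last first.
  by move=> z zp; rewrite eq_sym (negPf zp) mul0r mul0r.
rewrite eqxx mul1r rmorphM rmorph_nat -coset_labelE eq_sym.
by rewrite -mulrA.
Qed.

End Kernels.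

Lemma toC_wsum (R : rcfType) N (m : 'I_N) L (F : seq 'I_N -> R) :
  wsum m L (fun w => real_complex R (F w)) = real_complex R (wsum m L F).
Proof.
elim: L F => //= L IH F; rewrite rmorph_sum.
by apply: eq_bigr => i _; rewrite IH.
Qed.

(** * Invariance and support of kernels as commutation relations *)

Section Invariance.
Variables (R : rcfType) (N d : nat).
Local Notation C := R[i].
Local Notation g := #|{: 'S_N}|.
Implicit Types (p q : 'S_N) (A : 'M[C]_g) (s n : nat).

Definition funperm_mx (h : 'S_N -> 'S_N) : 'M[C]_g :=
  \matrix_(i, j) (enum_val i == h (enum_val j))%:R.

Lemma entry_funperm_mxr A h p q : entry (A *m funperm_mx h) p q = entry A p (h q).
Proof.
rewrite entryM (bigD1 (h q)) //= big1 ?addr0.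
  by rewrite [X in _ * X]mxE !enum_rankK eqxx mulr1.
by move=> r rq; rewrite [X in _ * X]mxE !enum_rankK (negPf rq) mulr0.
Qed.

Lemma entry_funperm_mxl A h h' p q : cancel h h' -> cancel h' h ->
  entry (funperm_mx h *m A) p q = entry A (h' p) q.
Proof.
move=> hK h'K; rewrite entryM (bigD1 (h' p)) //= big1 ?addr0.
  by rewrite [X in X * _]mxE !enum_rankK h'K eqxx mul1r.
move=> r rq; rewrite [X in X * _]mxE !enum_rankK; case: eqP => [e|]; last by rewrite mul0r.
by rewrite e hK eqxx in rq.
Qed.

Lemma funperm_mx_commP A h h' : cancel h h' -> cancel h' h ->
  A *m funperm_mx h = funperm_mx h *m A <-> forall p q, entry A (h p) (h q) = entry A p q.
Proof.
move=> hK h'K; split=> [e p q|e].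
  by rewrite -entry_funperm_mxr e (entry_funperm_mxl _ _ _ hK h'K) hK.
by apply: entryP => p q; rewrite entry_funperm_mxr (entry_funperm_mxl _ _ _ hK h'K) -[in RHS]e
  h'K.
Qed.

Definition pred_mx (b : pred 'S_N) : 'M[C]_g := diag_mx (\row_i (b (enum_val i))%:R).

Lemma pred_mx_commP A b :
  A *m pred_mx b = pred_mx b *m A <-> forall p q, b p != b q -> entry A p q = 0.
Proof.
rewrite /pred_mx mul_mx_diag mul_diag_mx; split=> [e p q|e].
  have := congr1 (fun B => entry B p q) e; rewrite /entry !mxE !enum_rankK.
  by case: (b p); case: (b q) => //; rewrite ?mulr1 ?mulr0 ?mul0r ?mul1r.
apply: entryP => p q; have := e p q; rewrite /entry !mxE !enum_rankK.
case: (b p); case: (b q) => //= h; rewrite ?mulr1 ?mul1r ?mulr0 ?mul0r //.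
  by rewrite h.
by rewrite h.
Qed.

Lemma lmul_commP A p : A *m funperm_mx (mulg p) = funperm_mx (mulg p) *m A <->
  forall q r, entry A (p * q)%g (p * r)%g = entry A q r.
Proof. by apply: (@funperm_mx_commP _ _ (mulg p^-1%g)); [exact: mulKg|exact: mulKVg]. Qed.

Lemma rmul_commP A p : A *m funperm_mx (mulg^~ p) = funperm_mx (mulg^~ p) *m A <->
  forall q r, entry A (q * p)%g (r * p)%g = entry A q r.
Proof. by apply: (@funperm_mx_commP _ _ (mulg^~ p^-1%g)) => q; rewrite ?mulgK ?mulgKV. Qed.

(** Commuting with these projections for all [l] confines the entries to pairs [p], [q] with
    [p^-1 * q] fixing [k]. *)
Definition vfix (k l : 'I_N) : pred 'S_N := fun p => p^-1%g k == l.

Lemma conv_mx_lmul f p : conv_mx f *m funperm_mx (mulg p) = funperm_mx (mulg p) *m conv_mx f.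
Proof. by apply/lmul_commP => q r; rewrite !entry_conv_mx invMg -mulgA mulKg. Qed.

Lemma conv_mx_rmul f p : (forall q r, f (q ^ r)%g = f q) ->
  conv_mx f *m funperm_mx (mulg^~ p) = funperm_mx (mulg^~ p) *m conv_mx f.
Proof.
move=> fJ; apply/rmul_commP => q r; rewrite !entry_conv_mx -(fJ (q^-1 * r)%g p).
by rewrite invMg conjMg /conjg !mulgA mulgK.
Qed.

Lemma conv_mx_vfix (f : 'S_N -> C) n (k l : 'I_N) : (n <= k)%N ->
  (forall p, ~~ fixes_above n p -> f p = 0) ->
  conv_mx f *m pred_mx (vfix k l) = pred_mx (vfix k l) *m conv_mx f.
Proof.
move=> nk f0; apply/pred_mx_commP => p q ne; rewrite entry_conv_mx f0 //.
apply: contra ne => /fixes_aboveP /(_ k nk); rewrite permM /vfix => e.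
by rewrite -{2}e permK.
Qed.

Lemma inv_conv_mx A : (forall p, A *m funperm_mx (mulg p) = funperm_mx (mulg p) *m A) ->
  A = conv_mx (fun p => entry A 1%g p).
Proof.
move=> Al; apply: entryP => p q; rewrite entry_conv_mx.
by have /lmul_commP/(_ 1%g (p^-1 * q)%g) := Al p; rewrite mulg1 mulKVg.
Qed.

Lemma inv_supp A n : (forall k l : 'I_N, (n <= k)%N ->
  A *m pred_mx (vfix k l) = pred_mx (vfix k l) *m A) ->
  forall p, ~~ fixes_above n p -> entry A 1%g p = 0.
Proof.
move=> Ad p; rewrite /fixes_above negb_forall => /existsP[k]; rewrite negb_imply => /andP[nk pk].
have /pred_mx_commP := Ad k k nk; apply.
rewrite /vfix invg1 perm1 eqxx eq_sym; apply: contra pk => /eqP e.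
by rewrite -{1}(eqP e) permKV.
Qed.

Lemma perm_traceC_supp n s p : ~~ fixes_above n p -> perm_traceC R d n s p = 0.
Proof. by move=> h; rewrite /perm_traceC /perm_trace ifN // rmorph0. Qed.

Lemma perm_traceCJ s p q : perm_traceC R d N s (p ^ q)%g = perm_traceC R d N s p.
Proof. by rewrite /perm_traceC /perm_trace !fixes_aboveN fixcountJ. Qed.

End Invariance.

(** * Densities on the joint spectrum, their conditional mean, variance and moments *)

Section Spectrum.
Variables (R : rcfType) (N d : nat).
Local Notation C := R[i].
Local Notation toC := (real_complex R).
Local Notation g := #|{: 'S_N}|.
Variables (P : 'M[C]_g) (c : 'I_N -> 'I_g -> R).
Hypotheses (Pu : P \is unitarymx) (Pc : forall m, conv_mx (jucys_murphy R m) = funmx P (c m)).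
Implicit Types (m : 'I_N) (s n : nat) (i : 'I_g).

(* At joint eigenvalues [c] of the Jucys-Murphy elements this is the density, with
   respect to Plancherel growth, of the Young diagram process of rank [s]. *)
Definition content_prod n s i : R := \prod_(m < N | (m < n)%N) (1 + c m i / s%:R).

Lemma perm_traceC_content_prod n s : (0 < s <= d)%N -> (n <= N)%N ->
  conv_mx (perm_traceC R d n s) = funmx P (content_prod n s).
Proof. by move=> sd nN; exact: (conv_mx_perm_traceC_funmx Pu Pc sd nN). Qed.

Lemma content_prod0 s i : content_prod 0 s i = 1.
Proof. by rewrite /content_prod big_pred0. Qed.

Lemma content_prodS m s i : content_prod m.+1 s i = content_prod m s i * (1 + c m i / s%:R).
Proof.
rewrite /content_prod (bigD1 m) //= mulrC; congr (_ * _); apply: eq_bigl => k.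
by rewrite ltnS -val_eqE /= ltn_neqAle andbC.
Qed.

Lemma content_prod_qform n s i : (0 < s <= d)%N -> (n <= N)%N ->
  toC (content_prod n s i) = (s ^ N)%:R^-1 *
    \sum_(x : {ffun 'I_N -> 'I_d} | color_bounded s x) \sum_z
     `|\sum_p (coset_label n x p == z)%:R * P i (enum_rank p)| ^+ 2.
Proof.
move=> sd nN; rewrite -(funmxK Pu (content_prod n s) i) -perm_traceC_content_prod //
  -perm_traceC_qform.
rewrite mxE [RHS]exchange_big /= -[RHS](sum_enum_val (fun q => \sum_p0 P i (enum_rank p0) *
  perm_traceC R d n s (p0^-1 * q)%g * (P i (enum_rank q))^*)).
apply: eq_bigr => j _; rewrite mxE mulr_suml.
rewrite -[RHS](sum_enum_val (fun p0 => P i (enum_rank p0) *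
  perm_traceC R d n s (p0^-1 * enum_val j)%g * (P i (enum_rank (enum_val j)))^*)).
by apply: eq_bigr => k _; rewrite !mxE !enum_valK.
Qed.

(** A single factor [1 + c m i / s] may be negative. The product is nonnegative as a diagonal entry,
    in the eigenbasis, of a positive semidefinite kernel. *)
Lemma content_prod_ge0 n s i : (0 < s <= d)%N -> (n <= N)%N -> 0 <= content_prod n s i.
Proof.
move=> sd nN; rewrite -ler0c content_prod_qform // mulr_ge0 ?invr_ge0 ?ler0n //.
by apply: sumr_ge0 => x _; apply: sumr_ge0 => z _; rewrite exprn_ge0.
Qed.

(** Absolute continuity of rank [r] with respect to rank [d]: the colorings bounded by [r] are among
    those bounded by [d], so the Gram sum at [r] is part of a vanishing sum. *)
Lemma content_prod_eq0 r i : (0 < r <= d)%N -> content_prod N d i = 0 -> content_prod N r i = 0.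
Proof.
move=> /andP[r0 rd] e; have d0 := leq_trans r0 rd.
have dd : (0 < d <= d)%N by rewrite d0 leqnn.
have := content_prod_qform i dd (leqnn N); rewrite e => /esym/eqP.
rewrite mulf_eq0 invr_eq0 pnatr_eq0 expn_eq0 (gtn_eqF d0) /= psumr_eq0; last first.
  by move=> x _; apply: sumr_ge0 => z _; rewrite exprn_ge0.
move=> /allP h; apply: complexI; rewrite content_prod_qform ?r0 // big1 ?mulr0 ?rmorph0 //.
move=> x /forallP xr; apply/eqP; have := h x; rewrite mem_index_enum => /(_ isT) /implyP.
by apply; apply/forallP => k; exact: leq_trans (xr k) rd.
Qed.

Section Products.
Variables (m : 'I_N) (r : nat) (phi : R -> R).
Hypothesis rd : (0 < r <= d)%N.
Let f i := phi (content_prod m r i * content_prod m d i).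

Let dd : (0 < d <= d)%N.
Proof. by case/andP: rd => r0 r1; rewrite leqnn (leq_trans r0 r1). Qed.

Let f_comm (A : 'M[C]_g) : (forall s, A *m conv_mx (perm_traceC R d m s) =
  conv_mx (perm_traceC R d m s) *m A) ->
  A *m funmx P f = funmx P f *m A.
Proof.
move=> Ac; apply: (funmx_comm_comp Pu).
have mN : (m <= N)%N := ltnW (ltn_ord m).
have e := funmxM Pu (content_prod m r) (content_prod m d).
apply: etrans (congr1 (mulmx A) (esym e)) (etrans _ (congr1 (mulmx^~ A) e)).
rewrite -!perm_traceC_content_prod // mulmxA Ac -mulmxA Ac mulmxA //.
Qed.

Let f_conv_mx : funmx P f = conv_mx (entry (funmx P f) 1%g).
Proof. by apply: inv_conv_mx => p; apply/esym/f_comm => s; rewrite conv_mx_lmul. Qed.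

Let f_supp p : ~~ fixes_above m p -> entry (funmx P f) 1%g p = 0.
Proof.
apply: inv_supp => k l mk; apply/esym/f_comm => s; apply/esym.
by apply: conv_mx_vfix mk _ => q; exact: perm_traceC_supp.
Qed.

(** [funmx P f] is convolution by a function supported on permutations of the first [m] points. The
    trace of its product with [J_m] reads this function at the transpositions [tperm i m], which
    move [m]. *)
Lemma sum_content_prod_c : \sum_i f i * c m i = 0.
Proof.
apply: complexI; rewrite -(mxtrace_funmx Pu) -(funmxM Pu) -Pc f_conv_mx conv_mx_jucys_murphy
  mxtrace_conv_mx.
rewrite big1 ?mulr0 ?rmorph0 // => i im; apply: f_supp.
rewrite mul1g; apply/negP => /fixes_aboveP /(_ m (leqnn _)); rewrite tpermR => e.
by move: im; rewrite e ltnn.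
Qed.

(** In [J_m ^ 2] only the [m] diagonal products [tperm i m * tperm i m] fix [m]; each equals the
    identity. *)
Lemma sum_content_prod_c2 : \sum_i f i * c m i ^+ 2 = (m : nat)%:R * \sum_i f i.
Proof.
apply: complexI; rewrite -(mxtrace_funmx Pu).
transitivity (\tr (funmx P f *m conv_mx (jucys_murphy R m) *m conv_mx (jucys_murphy R m))).
  rewrite Pc !(funmxM Pu); congr (\tr _); apply: eq_funmx => i.
  by rewrite expr2 mulrA.
have -> : toC ((m : nat)%:R * \sum_i f i) = (m : nat)%:R * \tr (funmx P f).
  by rewrite mxtrace_funmx // rmorphM rmorph_nat.
rewrite f_conv_mx !conv_mx_jucys_murphy !mxtrace_conv_mx.
rewrite mulrCA; congr (_ * _).
rewrite (eq_bigr (fun=> entry (funmx P f) 1%g 1%g)) => [|i im]; last first.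
  rewrite (bigD1 i) //= mul1g tperm2 big1 ?addr0 // => j /andP[jucys_murphy ji].
  apply: f_supp; apply/negP => /fixes_aboveP /(_ m (leqnn _)).
  have mi : i != m by apply: contraTneq im => ->; rewrite ltnn.
  rewrite permM tpermR tpermD ?(eq_sym m) // => e.
  by rewrite e eqxx in mi.
rewrite sumr_const card_ord_lt; last exact: ltnW.
by rewrite mulr_natl.
Qed.

End Products.

Lemma sum_content_prod_moment m s L : (0 < s <= d)%N ->
  \sum_i content_prod m s i * c m i ^+ L =
  g%:R * wsum m L (fun w => perm_trace d R m s (word_perm m w)).
Proof.
move=> sd; apply: complexI; rewrite -(mxtrace_funmx Pu).
have -> : funmx P (fun i => content_prod m s i * c m i ^+ L) =
    iter L (fun A => A *m conv_mx (jucys_murphy R m)) (conv_mx (perm_traceC R d m s)).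
  elim: L => [|L IH] /=.
    rewrite [RHS](perm_traceC_content_prod sd (ltnW (ltn_ord m))).
    by apply: eq_funmx => i; rewrite expr0 mulr1.
  rewrite -IH Pc (funmxM Pu); apply: eq_funmx => i.
  by rewrite exprSr mulrA.
rewrite conv_mx_jucys_murphy_word mxtrace_conv_mx.
have -> W : toC (g%:R * W) = g%:R * toC W by rewrite rmorphM rmorph_nat.
rewrite -toC_wsum; congr (_ * _).
by apply: eq_wsum => w; rewrite mul1g.
Qed.

End Spectrum.

(** * The Bhattacharyya coefficient *)

(** Let [t] be the left side and [D = (a - b) ^ 2]. Then [a * b - t ^ 2 = D * (2 * (a + b) - 1 - D)
    / 4], and [t > 0] gives [D < a + b], so [a + b >= 1] makes this nonnegative. *)
Lemma sqrt_mul_ge_mean (R : rcfType) (a b : R) : 0 <= a -> 0 <= b -> 1 <= a + b ->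
  (a + b) / 2 - (a - b) ^+ 2 / 2 <= Num.sqrt (a * b).
Proof.
move=> a0 b0 ab; set t := (X in X <= _).
have [t0|t0] := leP t 0; first exact: le_trans t0 (sqrtr_ge0 _).
rewrite -(ger0_norm (ltW t0)) -sqrtr_sqr ler_wsqrtr //.
have D0 := sqr_ge0 (a - b).
have -> : a * b = t ^+ 2 + (a - b) ^+ 2 * (2 * (a + b) - 1 - (a - b) ^+ 2) / 4.
  by rewrite /t; field.
rewrite lerDl divr_ge0 // mulr_ge0 //; rewrite /t in t0; lra.
Qed.

Lemma sqrt_mul_le_mean (R : rcfType) (a b : R) : 0 <= a -> 0 <= b ->
  Num.sqrt (a * b) <= (a + b) / 2.
Proof.
move=> a0 b0; have t0 : 0 <= (a + b) / 2 by lra.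
rewrite -[leRHS](ger0_norm t0) -sqrtr_sqr ler_wsqrtr //.
have -> : ((a + b) / 2) ^+ 2 = a * b + (a - b) ^+ 2 / 4 by field.
by rewrite lerDl divr_ge0 ?sqr_ge0.
Qed.

(* The last term makes the inequality trivial when [c < - r / 2]. *)
Lemma sqrt_density_step (R : rcfType) (r d c X Y : R) (k : nat) :
  0 < r -> r <= d -> 0 <= X -> 0 <= Y ->
  0 <= X * (1 + c / r) -> 0 <= Y * (1 + c / d) ->
  Num.sqrt (X * Y) * (1 + c * ((r^-1 + d^-1) / 2) - c ^+ 2 * ((r^-1 - d^-1) ^+ 2 / 2)
      - (2 / r) ^+ (2 * k) * c ^+ (2 * k)) <=
  Num.sqrt ((X * (1 + c / r)) * (Y * (1 + c / d))).
Proof.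
move=> r0 rd X0 Y0 XA YB.
have d0 := lt_le_trans r0 rd.
(* The factors [1 + c / r] and [1 + c / d] are known to be nonnegative only where [X] and [Y] are
   nonzero; elsewhere both sides vanish. *)
have [->|Xn] := eqVneq X 0; first by rewrite !mul0r !sqrtr0 mul0r.
have [->|Yn] := eqVneq Y 0; first by rewrite mul0r mulr0 mulr0 !sqrtr0 mul0r.
have Xp : 0 < X by rewrite lt_def Xn.
have Yp : 0 < Y by rewrite lt_def Yn.
move: XA YB; rewrite !pmulr_rge0 // => A0 B0.
rewrite [X * _ * _]mulrACA [leRHS]sqrtrM; last by rewrite mulr_ge0.
apply: ler_wpM2l; first exact: sqrtr_ge0.
rewrite -exprMn exprM; set e := _ ^+ k.
have e0 : 0 <= e by rewrite /e exprn_ge0 // sqr_ge0.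
have ri : 0 < r^-1 by rewrite invr_gt0.
have di : 0 < d^-1 by rewrite invr_gt0.
have dr : d^-1 <= r^-1 by rewrite lef_pV2.
have [cr|cr] := leP (- (1 / 2)) (c / r).
  apply: le_trans (_ : _ <= (1 + c / r + (1 + c / d)) / 2 - (1 + c / r - (1 + c / d)) ^+ 2 / 2) _.
    rewrite -subr_ge0 (_ : _ - _ = e) //; move: (e) => e'; field.
    by rewrite !gt_eqF.
  apply: sqrt_mul_ge_mean => //.
  have [c0|c0] := leP 0 c.
    have := mulr_ge0 c0 (ltW ri); have := mulr_ge0 c0 (ltW di); lra.
  have : c / r <= c / d by rewrite ler_nM2l.
  lra.
apply: le_trans (_ : _ <= 0) _; last exact: sqrtr_ge0.
have c0 : c < 0.
  by rewrite -(pmulr_llt0 c ri); apply: lt_trans cr _; lra.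
have e1 : 1 <= e.
  apply: exprn_ege1; set u := c / r in cr; have -> : 2 / r * c = 2 * u by rewrite /u mulrA mulrAC.
  nra.
have h1 : c * ((r^-1 + d^-1) / 2) <= 0 by rewrite mulr_le0_ge0 ?ltW //; lra.
have h2 : 0 <= c ^+ 2 * ((r^-1 - d^-1) ^+ 2 / 2).
  by rewrite mulr_ge0 ?sqr_ge0 // divr_ge0 ?sqr_ge0 //; lra.
lra.
Qed.

Section Bhattacharyya.
Variables (R : rcfType) (N d : nat).
Local Notation C := R[i].
Local Notation g := #|{: 'S_N}|.
Variables (P : 'M[C]_g) (c : 'I_N -> 'I_g -> R).
Hypotheses (Pu : P \is unitarymx) (Pc : forall m, conv_mx (jucys_murphy R m) = funmx P (c m)).
Variables (r k : nat).
Hypotheses (rd : (0 < r <= d)%N) (Nr : (N <= r ^ 2)%N).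
Local Notation content_prod := (content_prod c).

Let dd : (0 < d <= d)%N.
Proof. by case/andP: rd => r0 r1; rewrite leqnn (leq_trans r0 r1). Qed.

Let Nd : (N <= d ^ 2)%N.
Proof. by apply: leq_trans Nr _; rewrite leq_exp2r //; case/andP: rd. Qed.

Let moment s (m : 'I_N) k' : (0 < s <= d)%N -> (N <= s ^ 2)%N ->
  \sum_i content_prod m s i * c m i ^+ (2 * k') <= g%:R * ((2 * k')`!%:R * N%:R ^+ k').
Proof.
move=> sd Ns; rewrite (sum_content_prod_moment Pu Pc _ _ sd) ler_wpM2l ?ler0n //.
have ms : (m <= s ^ 2)%N := leq_trans (ltnW (ltn_ord m)) Ns.
apply: le_trans (wsum_perm_trace R k' sd ms) _.
by rewrite ler_wpM2l ?ler0n // lerXn2r ?nnegrE ?ler0n // ler_nat ltnW.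
Qed.

(** Unnormalized: the two densities have total mass [g], the number of permutations. *)
Definition bhattacharyya n := \sum_i Num.sqrt (content_prod n r i * content_prod n d i).

Let delta : R := r%:R^-1 - d%:R^-1.

(** The geometric mean of the densities is at most their average, so moments at the two ranks
    suffice. *)
Let sqrt_moment (m : 'I_N) k' :
  \sum_i Num.sqrt (content_prod m r i * content_prod m d i) * c m i ^+ (2 * k') <=
    g%:R * ((2 * k')`!%:R * N%:R ^+ k').
Proof.
have mN := ltnW (ltn_ord m).
have h1 := moment m k' rd Nr; have h2 := moment m k' dd Nd.
apply: le_trans (_ : _ <= (\sum_i content_prod m r i * c m i ^+ (2 * k') +
  \sum_i content_prod m d i * c m i ^+ (2 * k')) / 2) _; last by lra.
rewrite -big_split /= mulr_suml; apply: ler_sum => i _.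
rewrite -mulrDl mulrAC ler_wpM2r //; first by rewrite exprM exprn_ge0 // sqr_ge0.
by apply: sqrt_mul_le_mean; [exact: (content_prod_ge0 Pu Pc _ rd)|exact: (content_prod_ge0 Pu
  Pc _ dd)].
Qed.

Lemma bhattacharyya_step (m : 'I_N) :
  bhattacharyya m - g%:R * (N%:R * (delta ^+ 2 / 2) +
    (2 / r%:R) ^+ (2 * k) * ((2 * k)`!%:R * N%:R ^+ k))
    <= bhattacharyya m.+1.
Proof.
have mN := ltnW (ltn_ord m).
have [r0 rd'] := andP rd.
have r0R : 0 < r%:R :> R by rewrite ltr0n.
have rdR : r%:R <= d%:R :> R by rewrite ler_nat.
pose U i := Num.sqrt (content_prod m r i * content_prod m d i).
apply: le_trans (_ : _ <= \sum_i (U i + U i * c m i * ((r%:R^-1 + d%:R^-1) / 2)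
   - U i * c m i ^+ 2 * (delta ^+ 2 / 2) - U i * c m i ^+ (2 * k) * (2 / r%:R) ^+ (2 * k))) _;
     last first.
  apply: ler_sum => i _; rewrite !content_prodS.
  have := @sqrt_density_step R r%:R d%:R (c m i) (content_prod m r i) (content_prod m d i) k
    r0R rdR.
  rewrite -!content_prodS => /(_ (content_prod_ge0 Pu Pc i rd mN) (content_prod_ge0 Pu Pc i dd mN)
    (content_prod_ge0 Pu Pc i rd (ltn_ord m)) (content_prod_ge0 Pu Pc i dd (ltn_ord m))).
  apply: le_trans; rewrite -/(U i) -/delta le_eqVlt; apply/orP; left; apply/eqP; ring.
rewrite !sumrB big_split /= -!mulr_suml.
rewrite (sum_content_prod_c Pu Pc _ Num.sqrt rd) (sum_content_prod_c2 Pu Pc _ Num.sqrt rd)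
  -/(bhattacharyya m).
have b0 : 0 <= bhattacharyya m by apply: sumr_ge0 => i _; exact: sqrtr_ge0.
(* This is the moment of order 0. *)
have b1 : bhattacharyya m <= g%:R.
  have := sqrt_moment m 0; rewrite muln0 fact0 !expr0 !mulr1.
  by under eq_bigr do rewrite expr0 mulr1.
have h := sqrt_moment m k.
have e0 : 0 <= (2 / r%:R : R) ^+ (2 * k) by rewrite exprM exprn_ge0 // sqr_ge0.
have mNR : (m : nat)%:R <= N%:R :> R by rewrite ler_nat.
have m0 : 0 <= (m : nat)%:R :> R by rewrite ler0n.
have h1 := ler_wpM2r e0 h.
have h2 : (m : nat)%:R * bhattacharyya m * (delta ^+ 2 / 2) <= g%:R * (N%:R * (delta ^+ 2 / 2)).
  rewrite [g%:R * (_ * _)]mulrCA mulrA ler_wpM2r ?divr_ge0 ?sqr_ge0 //.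
  by rewrite ler_pM.
rewrite mul0r addr0 mulrDr opprD addrA; apply: lerB; first exact: lerB.
by rewrite [X in g%:R * X]mulrC mulrA.
Qed.

(** The [N] steps telescope from the initial value [g], so the main loss is of order
    [(N * delta) ^ 2]. *)
Lemma bhattacharyya_ge :
  g%:R * (1 - N%:R * (N%:R * (delta ^+ 2 / 2) +
    (2 / r%:R) ^+ (2 * k) * ((2 * k)`!%:R * N%:R ^+ k)))
    <= bhattacharyya N.
Proof.
set e := (X in 1 - N%:R * X).
suff h n : (n <= N)%N -> g%:R * (1 - n%:R * e) <= bhattacharyya n by exact: h.
elim: n => [_|n IH nN].
  rewrite mul0r subr0 mulr1 /bhattacharyya; under eq_bigr do rewrite !content_prod0 mulr1 sqrtr1.
  by rewrite sumr_const card_ord.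
apply: le_trans (bhattacharyya_step (Ordinal nN)); rewrite -/e -natr1.
by rewrite mulrDl mul1r opprD addrA mulrBr lerB // IH // ltnW.
Qed.

End Bhattacharyya.

(** * Permutation-symmetric testers *)

Section QuadraticForms.
Variables (C : numClosedFieldType) (I : finType).
Implicit Types (T : I -> I -> C) (v w b : I -> C).

(** The weights 1 and 1/2 cancel the cross terms between [b] and [w]. The factor 3/2 is chosen so
    that 3/2 times the rejection bound 1/3 stays below 2/3. *)
Lemma qform_split T b w :
  qform T (fun x => b x + w x) + qform T (fun x => b x - 2 * w x) / 2 =
  3 / 2 * qform T b + 3 * qform T w.
Proof.
rewrite /qform mulr_suml !mulr_sumr -!big_split; apply: eq_bigr => x _ /=.
rewrite mulr_suml !mulr_sumr -!big_split; apply: eq_bigr => y _ /=.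
rewrite rmorphD rmorphB rmorphM rmorph_nat.
by field.
Qed.

Lemma effect_perturb T b w : is_effect T ->
  qform T (fun x => b x + w x) <= 3 / 2 * qform T b + 3 * \sum_x (w x)^* * w x.
Proof.
move=> Te; have [h1 _] := Te (fun x => b x - 2 * w x); have [_ h2] := Te w.
apply: le_trans (_ : _ <= 3 / 2 * qform T b + 3 * qform T w) _.
  by rewrite -qform_split lerDl divr_ge0.
by rewrite lerD2l ler_wpM2l.
Qed.

End QuadraticForms.

Section Symmetric.
Variables (R : rcfType) (N d : nat).
Local Notation C := R[i].
Local Notation toC := (real_complex R).
Local Notation g := #|{: 'S_N}|.
Local Notation I := (copies_idx d N).
Implicit Types (p q : 'S_N) (x y : I) (s n : nat).

Definition act_pair (h : 'S_N * 'S_N) y : I := [ffun k => ((y (h.1 k)).1, (y (h.2 k)).2)].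

Lemma qform_act_pair (T : I -> I -> C) (t : 'S_N * 'S_N -> C) (v : I -> C) :
  (forall x y, T x y = \sum_h t h * (x == act_pair h y)%:R) ->
  qform T v = \sum_h t h * \sum_y (v (act_pair h y))^* * v y.
Proof.
move=> TE; rewrite /qform exchange_big /=.
under [RHS]eq_bigr do rewrite mulr_sumr.
rewrite [RHS]exchange_big /=; apply: eq_bigr => y _.
under eq_bigr => x _ do rewrite TE mulr_sumr mulr_suml.
rewrite exchange_big /=; apply: eq_bigr => h _.
rewrite (bigD1 (act_pair h y)) //= big1 ?addr0; last first.
  by move=> x /negPf ->; rewrite mulr0 mulr0 mul0r.
by rewrite eqxx mulr1 mulrCA mulrA.
Qed.

Definition usc_diag s : 'M[C]_d :=
  \matrix_(i, j) ((sqrtC s%:R)^-1 * ((i == j) && (i < s)%N)%:R).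

Lemma invsqrtC_conj s : ((sqrtC (s%:R : C))^-1)^* * (sqrtC s%:R)^-1 = s%:R^-1.
Proof.
have h : 0 <= (sqrtC (s%:R : C))^-1 by rewrite invr_ge0 sqrtC_ge0 ler0n.
by rewrite (conj_Creal (ger0_real h)) -expr2 exprVn sqrtCK.
Qed.

Lemma tens_pow_diag s x : tens_pow (usc_diag s) x =
  (sqrtC s%:R)^-1 ^+ N * [forall k, ((x k).1 == (x k).2) && ((x k).1 < s)%N]%:R.
Proof.
rewrite /tens_pow; under eq_bigr do rewrite mxE.
rewrite big_split /= prodr_const card_ord; congr (_ * _).
case: forallP => [h|/forallP].
  by rewrite big1 // => k _; rewrite h.
rewrite negb_forall => /existsP[k hk].
by rewrite (bigD1 k) //= (negPf hk) mul0r.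
Qed.

Lemma perm_traceC_count s p q : perm_traceC R d N s (p^-1 * q)%g =
  (s%:R^-1) ^+ N *
  \sum_(z : {ffun 'I_N -> 'I_d} | color_bounded s z) [forall k, z (p k) == z (q k)]%:R.
Proof.
rewrite /perm_traceC /perm_trace fixes_aboveN rmorphM fmorphV !rmorph_nat mulrC natrX exprVn;
  congr (_ * _).
rewrite /fixcount -sum1_card natr_sum big_mkcond [RHS]big_mkcond.
apply: eq_bigr => z _; rewrite inE; case: (color_bounded s z) => //=.
have -> : color_fixed (p^-1 * q)%g z = [forall k, z (p k) == z (q k)].
  apply/forallP/forallP => h k.
    by have := h (p k); rewrite permM permK eq_sym.
  by have := h (p^-1%g k); rewrite permKV permM eq_sym.
by case: forallP.
Qed.

Lemma qform_tens_pow (T : I -> I -> C) (t : 'S_N * 'S_N -> C) s :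
  (forall x y, T x y = \sum_h t h * (x == act_pair h y)%:R) ->
  qform T (@tens_pow C d N (usc_diag s)) =
    \sum_h t h * perm_traceC R d N s (h.1^-1 * h.2)%g.
Proof.
move=> TE; rewrite (qform_act_pair _ TE); apply: eq_bigr => h _; congr (_ * _).
rewrite perm_traceC_count -invsqrtC_conj exprMn mulr_sumr.
pose dg (z : {ffun 'I_N -> 'I_d}) : I := [ffun k => (z k, z k)].
pose undg (x : I) : {ffun 'I_N -> 'I_d} := [ffun k => (x k).1].
rewrite (bigID (fun y : I => [forall k, ((y k).1 == (y k).2) && ((y k).1 < s)%N])) /=.
rewrite [X in _ + X]big1 ?addr0; last first.
  by move=> y /negPf hy; rewrite !tens_pow_diag hy !mulr0.
rewrite (reindex_onto dg undg) /=; last first.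
  move=> y /forallP hy; apply/ffunP => k; rewrite !ffunE.
  by have /andP[/eqP e _] := hy k; rewrite {2}e -surjective_pairing.
apply: eq_big => [z|z /andP[hz _]].
  have -> : undg (dg z) = z by apply/ffunP => k; rewrite !ffunE.
  rewrite eqxx andbT; apply: eq_forallb => k; by rewrite ffunE /= eqxx.
rewrite !tens_pow_diag hz mulr1 rmorphM rmorphXn rmorph_nat mulrAC; congr (_ * _).
have zs k : (z k < s)%N.
  by move: hz => /forallP/(_ k); rewrite ffunE => /andP[].
congr ((_ : bool)%:R); apply: eq_forallb => k.
by rewrite !ffunE /= zs andbT.
Qed.

(* [d^(-N/2) sum_p A(1,p) (p (x) 1) Omega], where [Omega] is the unnormalized
   maximally entangled vector of ((C^d)^(x)N)^(x)2. *)
Definition twisted (A : 'M[C]_g) x : C :=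
  (sqrtC d%:R)^-1 ^+ N *
  \sum_p entry A 1%g p * [forall k, (x k).1 == (x (p k)).2]%:R.

Lemma twisted_overlap (h : 'S_N * 'S_N) p q : (0 < d)%N ->
  \sum_(y : I) [forall k, (act_pair h y k).1 == (act_pair h y (p k)).2]%:R *
         [forall k, (y k).1 == (y (q k)).2]%:R =
  d%:R ^+ N * perm_traceC R d N d ((h.1 * q)^-1 * (p * h.2))%g.
Proof.
move=> d0; rewrite perm_traceC_count mulrA -exprMn divff ?pnatr_eq0 -?lt0n // expr1n mul1r.
pose gr (z : {ffun 'I_N -> 'I_d}) : I := [ffun k => (z (q k), z k)].
pose ungr (x : I) : {ffun 'I_N -> 'I_d} := [ffun k => (x k).2].
rewrite (bigID (fun y : I => [forall k, (y k).1 == (y (q k)).2])) /=.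
rewrite [X in _ + X]big1 ?addr0; last first.
  by move=> y /negPf ->; rewrite mulr0.
rewrite (reindex_onto gr ungr) /=; last first.
  move=> y /forallP hy; apply/ffunP => k; rewrite !ffunE.
  by rewrite -(eqP (hy k)) -surjective_pairing.
apply: eq_big => [z|z /andP[hz _]].
  have -> : ungr (gr z) = z by apply/ffunP => k; rewrite !ffunE.
  rewrite eqxx andbT; have -> : color_bounded d z by apply/forallP.
  by apply/forallP => k; rewrite !ffunE /=.
rewrite hz mulr1; congr ((_ : bool)%:R); apply: eq_forallb => k.
by rewrite !ffunE /= !permM.
Qed.

(** Twisting by a Hermitian two-sided invariant [A] replaces the rank [d] kernel [K] by
    [A *m K *m A]: the overlaps of the permuted copies of [Omega] are the entries of [K]. *)
Lemma qform_twisted (T : I -> I -> C) (t : 'S_N * 'S_N -> C) (A : 'M[C]_g) : (0 < d)%N ->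
  (forall x y, T x y = \sum_h t h * (x == act_pair h y)%:R) ->
  A^t* = A ->
  (forall p q r, entry A (p * q)%g (p * r)%g = entry A q r) ->
  (forall p q r, entry A (q * p)%g (r * p)%g = entry A q r) ->
  qform T (twisted A) =
    \sum_h t h * entry (A *m conv_mx (perm_traceC R d N d) *m A) 1%g (h.1^-1 * h.2)%g.
Proof.
move=> d0 TE Ah Al Ar; rewrite (qform_act_pair _ TE); apply: eq_bigr => h _; congr (_ * _).
have Aconj p q : (entry A p q)^* = entry A q p by rewrite -{2}Ah /entry !mxE.
transitivity (d%:R^-1 ^+ N * \sum_p \sum_q (entry A p 1%g * entry A 1%g q) *
    \sum_(y : I) [forall k, (act_pair h y k).1 == (act_pair h y (p k)).2]%:R *
         [forall k, (y k).1 == (y (q k)).2]%:R).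
  rewrite -invsqrtC_conj exprMn mulr_sumr.
  under [RHS]eq_bigr => p _ do rewrite mulr_sumr.
  under [RHS]eq_bigr => p _ do under eq_bigr => q _ do rewrite !mulr_sumr.
  under [RHS]eq_bigr => p _ do rewrite exchange_big /=.
  rewrite [RHS]exchange_big /=; apply: eq_bigr => y _.
  have -> : (twisted A (act_pair h y))^* = ((sqrtC d%:R)^-1)^* ^+ N *
      \sum_p entry A p 1%g * [forall k, (act_pair h y k).1 == (act_pair h y (p k)).2]%:R.
    rewrite rmorphM rmorphXn rmorph_sum; congr (_ * _); apply: eq_bigr => p _.
    by rewrite rmorphM rmorph_nat; congr (_ * _); exact: Aconj.
  rewrite mulrACA mulr_suml mulr_sumr.
  apply: eq_bigr => p _; rewrite mulr_sumr mulr_sumr; apply: eq_bigr => q _.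
  by congr (_ * _); rewrite mulrACA.
under eq_bigr => p _ do under eq_bigr => q _ do rewrite twisted_overlap // mulrCA.
under eq_bigr => p _ do rewrite -mulr_sumr.
rewrite -mulr_sumr mulrA -exprMn mulVf ?pnatr_eq0 -?lt0n // expr1n mul1r.
rewrite entryM [RHS](reindex_inj (mulgI h.1^-1%g)) /= [RHS](reindex_inj (mulIg h.2)) /=.
apply: eq_bigr => p _; rewrite entryM mulr_suml; apply: eq_bigr => q _.
have e : entry A (p * h.2)%g h.2 = entry A p 1%g by rewrite -{2}[h.2]mul1g Ar.
rewrite entry_conv_mx Al e invMg !mulgA.
by rewrite [RHS]mulrC mulrA.
Qed.

Lemma twistedD (A B : 'M[C]_g) x : twisted (A + B) x = twisted A x + twisted B x.
Proof.
rewrite /twisted -mulrDr -big_split; congr (_ * _); apply: eq_bigr => p _.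
by rewrite /entry mxE mulrDl.
Qed.

(** * Twisting by the likelihood ratio and the Hellinger distance *)

Section Distinguish.
Variables (P : 'M[C]_g) (c : 'I_N -> 'I_g -> R) (r : nat).
Hypotheses (Pu : P \is unitarymx) (Pc : forall m, conv_mx (jucys_murphy R m) = funmx P (c m)).
Hypothesis rd : (0 < r <= d)%N.
Local Notation content_prod := (content_prod c).

Let d0 : (0 < d)%N.
Proof. by case/andP: rd => r0 r1; exact: leq_trans r0 r1. Qed.

Let dd : (0 < d <= d)%N.
Proof. by rewrite leqnn d0. Qed.

(** Where the denominator vanishes the quotient is 0 by convention, and so is the density of rank
    [r]; hence [likM] holds everywhere. *)
Let lik i := content_prod N r i / content_prod N d i.

Let lik_comm (A : 'M[C]_g) (phi : R -> R) :
  (forall s, A *m conv_mx (perm_traceC R d N s) = conv_mx (perm_traceC R d N s) *m A) ->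
  A *m funmx P (fun i => phi (lik i)) = funmx P (fun i => phi (lik i)) *m A.
Proof.
move=> Ac; apply: (funmx_comm_comp Pu).
have er : A *m funmx P (content_prod N r) = funmx P (content_prod N r) *m A.
  by rewrite -(perm_traceC_content_prod Pu Pc rd (leqnn N)).
have ed : A *m funmx P (content_prod N d) = funmx P (content_prod N d) *m A.
  by rewrite -(perm_traceC_content_prod Pu Pc dd (leqnn N)).
have {}ed := funmx_comm_comp Pu GRing.inv ed.
have e := funmxM Pu (content_prod N r) (fun i => (content_prod N d i)^-1).
apply: etrans (congr1 (mulmx A) (esym e)) (etrans _ (congr1 (mulmx^~ A) e)).
by rewrite mulmxA er -mulmxA ed mulmxA.
Qed.

Let lik_lmul phi p q (s : 'S_N) : entry (funmx P (fun i => phi (lik i))) (p * q)%g (p * s)%g =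
  entry (funmx P (fun i => phi (lik i))) q s.
Proof.
have /lmul_commP -> // : funmx P (fun i => phi (lik i)) *m funperm_mx R (mulg p) =
  funperm_mx R (mulg p) *m funmx P (fun i => phi (lik i)).
by apply/esym/lik_comm => s'; rewrite conv_mx_lmul.
Qed.

Let lik_rmul phi p q (s : 'S_N) : entry (funmx P (fun i => phi (lik i))) (q * p)%g (s * p)%g =
  entry (funmx P (fun i => phi (lik i))) q s.
Proof.
have /rmul_commP -> // : funmx P (fun i => phi (lik i)) *m funperm_mx R (mulg^~ p) =
  funperm_mx R (mulg^~ p) *m funmx P (fun i => phi (lik i)).
apply/esym/lik_comm => s'; apply/esym/conv_mx_rmul => *; exact: perm_traceCJ.
Qed.

Let lik_qform T t phi : (forall x y, T x y = \sum_h t h * (x == act_pair h y)%:R) ->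
  qform T (twisted (funmx P (fun i => phi (lik i)))) =
  \sum_h t h * entry (funmx P (fun i =>
    content_prod N d i * phi (lik i) ^+ 2)) 1%g (h.1^-1 * h.2)%g.
Proof.
move=> TE; rewrite (qform_twisted d0 TE); [|exact: funmx_herm|exact: lik_lmul|exact: lik_rmul].
apply: eq_bigr => h _; congr (_ * entry _ _ _).
rewrite (perm_traceC_content_prod Pu Pc dd (leqnn N)).
apply: etrans (congr1 (mulmx^~ _) (funmxM Pu _ _)) (etrans (funmxM Pu _ _) _).
by apply: eq_funmx => i; rewrite expr2 mulrA [_ * content_prod _ _ _]mulrC.
Qed.

Let lik_ge0 i : 0 <= lik i.
Proof.
apply: divr_ge0; first exact: (content_prod_ge0 Pu Pc i rd (leqnn N)).
exact: (content_prod_ge0 Pu Pc i dd (leqnn N)).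
Qed.

Let likM i : content_prod N d i * lik i = content_prod N r i.
Proof.
have [e|ne] := eqVneq (content_prod N d i) 0;
  first by rewrite e mul0r (content_prod_eq0 Pu Pc rd e).
by rewrite /lik mulrCA divff // mulr1.
Qed.

(** A fidelity argument: [twisted G] and [twisted O] are accepted as often as the states of rank [r]
    and [d], and [g] times their squared distance is [2 * (g - bhattacharyya d c r N)]. A tester
    separates the two vectors, so this distance cannot be small. *)
Lemma tester_bhattacharyya (T : I -> I -> C) (t : 'S_N * 'S_N -> C) :
  (forall x y, T x y = \sum_h t h * (x == act_pair h y)%:R) -> is_effect T ->
  2%:R / 3%:R <= qform T (@tens_pow C d N (usc_diag r)) ->
  qform T (@tens_pow C d N (usc_diag d)) <= 1 / 3%:R ->
  bhattacharyya d c r N <= 35 / 36 * g%:R.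
Proof.
move=> TE Teff hr hd.
pose B := funmx P (fun i => Num.sqrt (lik i) - 1).
pose O := funmx P (fun i => (fun=> 1 : R) (lik i)).
pose G := funmx P (fun i => Num.sqrt (lik i)).
have GE : G = O + B.
  have := funmxZD P 1 (fun=> 1) (fun i => Num.sqrt (lik i) - 1).
  rewrite rmorph1 scale1r => <-; apply: eq_funmx => i; by rewrite mul1r addrC subrK.
have qG : qform T (twisted G) = qform T (@tens_pow C d N (usc_diag r)).
  rewrite (lik_qform Num.sqrt TE) (qform_tens_pow r TE); apply: eq_bigr => h _.
  congr (_ * _).
  have := entry_conv_mx (perm_traceC R d N r) 1%g (h.1^-1 * h.2)%g; rewrite invg1 mul1g => <-.
  rewrite (perm_traceC_content_prod Pu Pc rd (leqnn N));
    apply: (congr1 (fun A => entry A _ _)); apply: eq_funmx => i.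
  by rewrite sqr_sqrtr.
have qO : qform T (twisted O) = qform T (@tens_pow C d N (usc_diag d)).
  rewrite (lik_qform (fun=> 1) TE) (qform_tens_pow d TE); apply: eq_bigr => h _.
  congr (_ * _).
  have := entry_conv_mx (perm_traceC R d N d) 1%g (h.1^-1 * h.2)%g; rewrite invg1 mul1g => <-.
  rewrite (perm_traceC_content_prod Pu Pc dd (leqnn N));
    apply: (congr1 (fun A => entry A _ _)); apply: eq_funmx => i.
  by rewrite expr1n mulr1.
have nB : g%:R * (\sum_x (twisted B x)^* * twisted B x) =
    toC (\sum_i (content_prod N r i + content_prod N d i) - 2 * bhattacharyya d c r N).
  (* The squared norm is the quadratic form of the identity, itself a combination of permutation
     operators, so [lik_qform] computes it. *)
  pose t0 (h : 'S_N * 'S_N) : C := (h == (1%g, 1%g))%:R.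
  have T0 (x y : I) : (x == y)%:R = \sum_h t0 h * (x == act_pair h y)%:R.
    rewrite (bigD1 (1%g, 1%g)) //= big1 ?addr0; last first.
      by move=> h /negPf hh; rewrite /t0 hh mul0r.
    rewrite /t0 eqxx mul1r; congr ((x == _)%:R); apply/ffunP => k.
    by rewrite ffunE /= !perm1 -surjective_pairing.
  have -> : \sum_x (twisted B x)^* * twisted B x =
      qform (fun x y => (x == y)%:R) (twisted B).
    apply: eq_bigr => x _; rewrite (bigD1 x) //= big1 ?addr0; last first.
      by move=> y; rewrite eq_sym => /negPf ->; rewrite mulr0 mul0r.
    by rewrite eqxx mulr1.
  rewrite (lik_qform (fun a => Num.sqrt a - 1) T0) (bigD1 (1%g, 1%g)) //= big1 ?addr0; last first.
    by move=> h /negPf hh; rewrite /t0 hh mul0r.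
  rewrite /t0 eqxx mul1r invg1 mulg1.
  set F := funmx _ _.
  have FE : F = conv_mx (entry F 1%g).
    rewrite /F; apply: inv_conv_mx => p.
    have e1 : funperm_mx R (mulg p) *m funmx P (content_prod N d) =
      funmx P (content_prod N d) *m funperm_mx R (mulg p).
      by rewrite -(perm_traceC_content_prod Pu Pc dd (leqnn N)) conv_mx_lmul.
    have e2 : funperm_mx R (mulg p) *m funmx P (fun i => (Num.sqrt (lik i) - 1) ^+ 2) =
        funmx P (fun i => (Num.sqrt (lik i) - 1) ^+ 2) *m funperm_mx R (mulg p).
      by apply: (@lik_comm _ (fun a => (Num.sqrt a - 1) ^+ 2)) => s; rewrite conv_mx_lmul.
    have e := funmxM Pu (content_prod N d) (fun i => (Num.sqrt (lik i) - 1) ^+ 2).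
    apply/esym; apply: etrans (congr1 (mulmx _) (esym e)) (etrans _ (congr1 (mulmx^~ _) e)).
    by rewrite mulmxA e1 -[LHS]mulmxA e2 mulmxA.
  rewrite -mxtrace_conv_mx -FE mxtrace_funmx //; congr toC.
  rewrite /bhattacharyya mulr_sumr -sumrB; apply: eq_bigr => i _.
  have -> : Num.sqrt (content_prod N r i * content_prod N d i) =
    content_prod N d i * Num.sqrt (lik i).
    rewrite -likM mulrAC -expr2 sqrtrM ?sqr_ge0 // sqrtr_sqr ger0_norm //.
    exact: (content_prod_ge0 Pu Pc _ dd (leqnn N)).
  have key (s l e : R) : s ^+ 2 = l -> e * (s - 1) ^+ 2 = e * l + e - 2 * (e * s).
    by move=> <-; ring.
  by rewrite -likM; apply: key; exact: sqr_sqrtr (lik_ge0 i).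
have sum_content_prod s : (0 < s <= d)%N -> \sum_i content_prod N s i = g%:R.
  move=> sd; apply: complexI; rewrite -(mxtrace_funmx Pu) -(perm_traceC_content_prod Pu Pc sd
    (leqnn N)).
  by rewrite mxtrace_conv_mx /perm_traceC perm_trace1 // rmorph1 mulr1 rmorph_nat.
have E : qform T (fun x => twisted O x + twisted B x) = qform T (twisted G).
  by rewrite GE /qform; apply: eq_bigr => x _; apply: eq_bigr => y _; rewrite !twistedD.
have := effect_perturb (twisted O) (twisted B) Teff.
rewrite [X in X <= _](etrans E qG) [X in _ * X + _]qO => h1.
have gp : 0 < g%:R :> R by rewrite ltr0n; apply/card_gt0P; exists 1%g.
have gpC : 0 < g%:R :> C by rewrite ltr0n -(ltr0n R).
move: nB; rewrite big_split /= !sum_content_prod // => nB.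
set n2 := \sum_x _ in h1 nB.
(* From [2/3 <= 1/2 + 3 * n2]; halving the bound on [n2] then gives the deficit 1/36 in the
   conclusion. *)
have h2 : 1 / 18 <= n2.
  have : 2 / 3 <= 3 / 2 * (1 / 3) + 3 * n2 :> C.
    apply: le_trans hr (le_trans h1 _); by rewrite lerD2r ler_wpM2l // divr_ge0.
  have key (z : C) : 3 / 2 * (1 / 3) + 3 * z - 2 / 3 = 3 * (z - 1 / 18) by field.
  by rewrite -[X in is_true X -> _]subr_ge0 key pmulr_rge0 ?ltr0n // subr_ge0.
have : toC (g%:R / 18) <= toC (g%:R + g%:R - 2 * bhattacharyya d c r N).
  rewrite -nB rmorphM fmorphV !rmorph_nat ler_pM2l //.
  by move: h2; rewrite mul1r.
rewrite lecR; lra.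
Qed.

End Distinguish.

End Symmetric.

(** * Zariski density of the unitary matrices *)

Lemma poly_natr_roots (F : numFieldType) (p : {poly F}) :
  (forall n : nat, p.[n%:R] = 0) -> p = 0.
Proof.
move=> p0; apply: (@roots_geq_poly_eq0 _ _ [seq n%:R | n <- iota 0 (size p)]).
- by apply/allP => _ /mapP[n _ ->]; rewrite /root p0.
- rewrite map_inj_uniq ?iota_uniq // => i j /eqP; rewrite eqr_nat => /eqP //.
- by rewrite size_map size_iota.
Qed.

Section UnitaryDense.
Variables (C : numClosedFieldType) (d N : nat) (J : finType).
Variables (w : J -> C) (a b : J -> 'I_N -> 'I_d).

(** A general homogeneous polynomial of degree [N] in the entries of [A]. *)
Definition mxform (A : 'M[C]_d) := \sum_j w j * \prod_k A (a j k) (b j k).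

Lemma mxformZ c A : mxform (c *: A) = c ^+ N * mxform A.
Proof.
rewrite /mxform mulr_sumr; apply: eq_bigr => j _; rewrite mulrCA; congr (_ * _).
under eq_bigr do rewrite mxE.
by rewrite big_split prodr_const card_ord.
Qed.

Hypothesis form0 : forall U : 'M[C]_d, U \is unitarymx -> mxform U = 0.

(* [adj(1 - H) (1 + H)] is a scalar multiple of the Cayley transform of [H]. *)
Lemma cayley_form0_antiherm (H : 'M[C]_d) : H^t* = - H ->
  mxform (\adj (1%:M - H) *m (1%:M + H)) = 0.
Proof.
move=> Hh; set M := _ *m _.
have adjm (X : 'M[C]_d) : (\adj X)^t* = \adj (X^t*) by rewrite trmx_adj map_mx_adj.
have t1 : (1%:M : 'M[C]_d)^t* = 1%:M by rewrite trmx1 map_mx1.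
have MM : M *m M^t* = (\det (1%:M - H) * \det (1%:M + H))%:M.
  have eP : (1%:M + H)^t* = 1%:M - H by rewrite linearD /= map_mxD t1 Hh.
  have eQ : (1%:M - H)^t* = 1%:M + H by rewrite linearB /= map_mxB t1 Hh opprK.
  have -> : M^t* = (1%:M - H) *m \adj (1%:M + H) by rewrite /M adjmxM adjm eP eQ.
  have comm : (1%:M + H) *m (1%:M - H) = (1%:M - H) *m (1%:M + H).
    transitivity (1%:M - H *m H).
      by rewrite mulmxBr mulmx1 mulmxDl mul1mx opprD addrA addrK.
    by rewrite mulmxDr mulmx1 mulmxBl mul1mx addrA subrK.
  rewrite /M mulmxA -[\adj _ *m _ *m _]mulmxA comm mulmxA mul_adj_mx.
  by rewrite -mulmxA mul_mx_adj -scalar_mxM.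
set mu := _ * _ in MM.
have [d0|d0] := posnP d.
  have -> : M = 1%:M by apply/matrixP => i; case: i => [i ii]; exfalso; move: ii; rewrite d0.
  by apply: form0; apply/unitarymxP; rewrite t1 mulmx1.
have mu0 : 0 <= mu.
  have := congr1 (fun X : 'M_d => X (Ordinal d0) (Ordinal d0)) MM.
  rewrite !mxE eqxx mulr1n => <-; apply: sumr_ge0 => j _.
  by rewrite !mxE mul_conjC_ge0.
have [mz|mn] := eqVneq mu 0.
  (* As a multiple of a unitary matrix, 0 falls under homogeneity even for [N = 0], when the form is
     constant. *)
  have -> : M = 0 *: 1%:M.
    rewrite scale0r; apply/matrixP => i j; rewrite [RHS]mxE.
    have := congr1 (fun X : 'M_d => X i i) MM; rewrite mz !mxE eqxx mulr1n => /eqP.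
    rewrite psumr_eq0; last by move=> k _; rewrite !mxE mul_conjC_ge0.
    move=> /allP/(_ j); rewrite mem_index_enum => /(_ isT); rewrite /= !mxE.
    by rewrite mul_conjC_eq0 => /eqP.
  by rewrite mxformZ form0 ?mulr0 //; apply/unitarymxP; rewrite t1 mulmx1.
have sm : sqrtC mu != 0 by rewrite sqrtC_eq0.
have -> : M = sqrtC mu *: ((sqrtC mu)^-1 *: M) by rewrite scalerA divff // scale1r.
rewrite mxformZ form0 ?mulr0 //; apply/unitarymxP.
have -> : ((sqrtC mu)^-1 *: M)^t* = (sqrtC mu)^-1 *: M^t*.
  rewrite linearZ /= map_mxZ; congr (_ *: _); apply: conj_Creal; apply: ger0_real.
  by rewrite invr_ge0 sqrtC_ge0.
rewrite -scalemxAl -scalemxAr scalerA MM -invfM -expr2 sqrtCK scale_scalar_mx mulVf //.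
Qed.

(* [Z = H + t K] at [t = 'i] with [H], [K] antihermitian; the form vanishes for all
   real [t] and is polynomial in [t]. *)
Lemma cayley_form0 (Z : 'M[C]_d) : mxform (\adj (1%:M - Z) *m (1%:M + Z)) = 0.
Proof.
pose H := 2^-1 *: (Z - Z^t*).
pose K := (- 'i / 2) *: (Z + Z^t*).
have Hh : H^t* = - H.
  rewrite /H linearZ /= map_mxZ linearB /= map_mxB trmxCK fmorphV rmorph_nat.
  by rewrite -scalerN opprB.
have Kh : K^t* = - K.
  rewrite /K linearZ /= map_mxZ linearD /= map_mxD trmxCK addrC -scaleNr.
  by rewrite rmorphM rmorphN fmorphV rmorph_nat /= conjCi mulNr.
have ZE : Z = H + 'i *: K.
  rewrite /H /K scalerA mulrA mulrN -expr2 sqrCi opprK mul1r -scalerDr.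
  by rewrite addrACA addNr addr0 -mulr2n -scaler_nat scalerA mulVf ?scale1r // pnatr_eq0.
move: H K Hh Kh ZE => H K Hh Kh ZE.
pose ZX : 'M[{poly C}]_d := map_mx polyC H + 'X *: map_mx polyC K.
pose MX := \adj (1%:M - ZX) *m (1%:M + ZX).
pose p : {poly C} := \sum_j (w j)%:P * \prod_k MX (a j k) (b j k).
have pE t : p.[t] = mxform (\adj (1%:M - (H + t *: K)) *m (1%:M + (H + t *: K))).
  have ME : map_mx (horner_eval t) MX =
      \adj (1%:M - (H + t *: K)) *m (1%:M + (H + t *: K)).
    have ZXE : map_mx (horner_eval t) ZX = H + t *: K.
      apply/matrixP => i j; rewrite !mxE /horner_eval hornerD hornerM hornerX !hornerC.
      by [].
    have gen (Y : 'M[{poly C}]_d) : map_mx (horner_eval t) (\adj (1%:M - Y) *m (1%:M + Y)) =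
        \adj (1%:M - map_mx (horner_eval t) Y) *m (1%:M + map_mx (horner_eval t) Y).
      by rewrite map_mxM map_mx_adj map_mxB map_mxD map_mx1.
    by rewrite /MX gen ZXE.
  rewrite /p horner_sum /mxform; apply: eq_bigr => j _.
  rewrite hornerM hornerC horner_prod -ME; congr (_ * _); apply: eq_bigr => k _.
  by rewrite [RHS]mxE.
have p0 : p = 0.
  apply: poly_natr_roots => n; rewrite pE; apply: cayley_form0_antiherm.
  by rewrite linearD /= map_mxD Hh linearZ /= map_mxZ Kh rmorph_nat scalerN opprD.
by rewrite {1 2}ZE -pE p0 horner0.
Qed.

(** Up to a nonzero scalar, [A] is a Cayley transform: for [k] not an eigenvalue and [A' = - A / k],
    the matrix [1 + A'] is invertible, and [Z = 1 - 2 * (1 + A')^-1] has transform [A']. *)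
Lemma mxform0 (A : 'M[C]_d) : mxform A = 0.
Proof.
have [n rn] : exists n : nat, ~~ root (char_poly A) n.+1%:R.
  case: (boolP (has (fun n => ~~ root (char_poly A) n.+1%:R) (iota 0 (size (char_poly A))))).
    by move=> /hasP[n _ hn]; exists n.
  rewrite -all_predC => /allP h; exfalso.
  have : char_poly A = 0.
    apply: (@roots_geq_poly_eq0 _ _ [seq n.+1%:R | n <- iota 0 (size (char_poly A))]).
    - by apply/allP => _ /mapP[n hn ->]; have := h n hn; rewrite /= negbK.
    - rewrite map_inj_uniq ?iota_uniq // => i j /eqP; rewrite eqr_nat => /eqP [] //.
    - by rewrite size_map size_iota.
  by move/eqP; rewrite (negPf (monic_neq0 (char_poly_monic A))).
set k := n.+1%:R : C in rn.
have k0 : k != 0 by rewrite pnatr_eq0.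
pose A' := - k^-1 *: A.
have Q0 : 1%:M + A' \in unitmx.
  have -> : 1%:M + A' = k^-1 *: (k%:M - A).
    by rewrite /A' scaleNr scalerBr scale_scalar_mx mulVf.
  rewrite unitmxZ ?unitfE ?invr_eq0 //; move: rn; rewrite -eigenvalue_root_char.
  rewrite /eigenvalue /eigenspace negbK kermx_eq0 row_free_unit.
  by rewrite -opprB -scaleN1r unitmxZ ?unitrN1.
pose W := invmx (1%:M + A').
have WK : W *m (1%:M + A') = 1%:M by rewrite mulVmx.
have KW : (1%:M + A') *m W = 1%:M by rewrite mulmxV.
pose Z := 1%:M - 2 *: W.
have Z1 : 1%:M - Z = 2 *: W by rewrite opprB addrC subrK.
have Z2 : 1%:M + Z = 2 *: (A' *m W).
  have -> : A' *m W = 1%:M - W by rewrite -KW mulmxDl mul1mx addrAC subrr add0r.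
  by rewrite /Z addrA scalerBr -mulr2n !scaler_nat.
have AW : W *m A' = A' *m W.
  have h1 : A' *m W = 1%:M - W by rewrite -KW mulmxDl mul1mx addrAC subrr add0r.
  by rewrite h1 -[X in X - _]WK mulmxDr mulmx1 addrAC subrr add0r.
have detQ : \det (2 *: W) != 0.
  by rewrite -unitfE -unitmxE unitmxZ ?unitfE ?pnatr_eq0 // unitmx_inv.
have := cayley_form0 Z; rewrite Z1 Z2.
have -> : \adj (2 *: W) *m (2 *: (A' *m W)) = \det (2 *: W) *: A'.
  rewrite -AW scalemxAl mulmxA mul_adj_mx; by rewrite mul_scalar_mx.
rewrite /A' scalerA mxformZ => /eqP; rewrite mulf_eq0 expf_eq0 => /orP[/andP[_]|/eqP //].
by rewrite mulf_eq0 (negPf detQ) oppr_eq0 invr_eq0 (negPf k0).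
Qed.

End UnitaryDense.

(** * The commutant of the local unitaries *)

Lemma span_by_annihilators (F : fieldType) (H K : finType) (p : H -> K -> F) (tau : K -> F) :
  (forall Y : K -> F, (forall h, \sum_k p h k * Y k = 0) -> \sum_k tau k * Y k = 0) ->
  exists t : H -> F, forall k, tau k = \sum_h t h * p h k.
Proof.
move=> ann.
pose M : 'M[F]_(#|H|, #|K|) := \matrix_(i, j) p (enum_val i) (enum_val j).
pose v : 'rV[F]_#|K| := \row_j tau (enum_val j).
have /submxP[D vD] : (v <= M)%MS.
  rewrite submxE; apply/eqP/matrixP => i j; rewrite ord1 [RHS]mxE mxE.
  apply: etrans (ann (fun k => cokermx M (enum_rank k) j) _) => [|h].
    apply: etrans (sum_enum_val _); apply: eq_bigr => k _.
    by rewrite [v _ _]mxE enum_valK.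
  have := congr1 (fun X : 'M_(_, _) => X (enum_rank h) j) (mulmx_coker M).
  rewrite [RHS]mxE; apply: etrans; rewrite mxE.
  apply: etrans (esym (sum_enum_val _)) _; apply: eq_bigr => k _.
  by rewrite [M _ _]mxE enum_rankK enum_valK.
exists (fun h => D 0 (enum_rank h)) => k.
have := congr1 (fun X : 'rV_ _ => X 0 (enum_rank k)) vD.
rewrite !mxE enum_rankK => ->; apply: etrans (sum_enum_val _).
by apply: eq_bigr => i _; rewrite mxE enum_rankK enum_valK.
Qed.

Section DoubleCommutant.
Variables (C : numClosedFieldType) (gT : finGroupType) (I : finType).
Variable (act : gT -> I -> I).
Hypotheses (act1 : forall x, act 1%g x = x).
Hypothesis (actM : forall h h' x, act (h * h')%g x = act h (act h' x)).

(** The sum of the translates of a matrix unit under the diagonal action; these span the commutant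
    of the permutation representation. *)
Definition orbital (a b : I) (x y : I) : C := \sum_(h : gT) ((x == act h a) && (y == act h b))%:R.

(** By duality, it suffices that every [Y] annihilating all group operators annihilates [T]. *)
Lemma double_commutant (T : I -> I -> C) :
  (forall a b x y, \sum_z T x z * orbital a b z y = \sum_z orbital a b x z * T z y) ->
  exists t : gT -> C, forall x y, T x y = \sum_h t h * (x == act h y)%:R.
Proof.
move=> Tc.
have [|t tE] := @span_by_annihilators C gT (I * I)%type
    (fun h k => (k.1 == act h k.2)%:R) (fun k => T k.1 k.2); last first.
  by exists t => x y; rewrite (tE (x, y)).
move=> Y' Y0; pose Y x y := Y' (x, y).
have {}Y0 h : \sum_y Y (act h y) y = 0.
  apply: etrans (Y0 h).
  transitivity (\sum_x \sum_y (x == act h y)%:R * Y x y); last first.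
    by rewrite pair_bigA; apply: eq_bigr => -[].
  rewrite exchange_big /=; apply: eq_bigr => y _;
    rewrite (bigD1 (act h y)) //= big1 ?addr0 ?eqxx ?mul1r //.
  by move=> x /negPf ->; rewrite mul0r.
pose F h := \sum_y \sum_x Y (act h x) y * T x y.
suff F0 : F 1%g = 0.
  rewrite -[RHS]F0; transitivity (\sum_x \sum_y T x y * Y x y).
    by rewrite pair_bigA; apply: eq_bigr => -[].
  rewrite exchange_big /=; apply: eq_bigr => y _; apply: eq_bigr => x _; by rewrite act1 mulrC.
(* The averaged Gram operator [O] of the functionals [Y] is an intertwiner, and
   its quadratic form at [T] is the sum of the [`|F h| ^+ 2]. *)
pose O y' y x' x := \sum_h (Y (act h x') y')^* * Y (act h x) y.
have OE y' y x' x : O y' y x' x = \sum_a \sum_b ((Y a y')^* * Y b y) * orbital a b x' x.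
  rewrite /O (reindex_inj invg_inj) /=.
  under [RHS]eq_bigr => a _ do under eq_bigr => b _ do rewrite mulr_sumr.
  under [RHS]eq_bigr => a _ do rewrite exchange_big /=.
  rewrite [RHS]exchange_big /=; apply: eq_bigr => h _.
  have eqa z a : (z == act h a) = (a == act h^-1%g z).
    by apply/eqP/eqP => ->; rewrite -actM ?mulVg ?mulgV act1.
  rewrite (bigD1 (act h^-1%g x')) //= [X in _ + X]big1 ?addr0; last first.
    move=> a ax; rewrite big1 // => b _.
    by rewrite eqa (negPf ax) mulr0.
  rewrite (bigD1 (act h^-1%g x)) //= [X in _ + X]big1 ?addr0; last first.
    move=> b bx; by rewrite [x == _]eqa (negPf bx) andbF mulr0.
  by rewrite !eqa !eqxx mulr1.
have Ocomm y' y x z : \sum_x' T x x' * O y' y x' z = \sum_x' O y' y x x' * T x' z.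
  under eq_bigr => x' _ do rewrite OE mulr_sumr.
  under [RHS]eq_bigr => x' _ do rewrite OE mulr_suml.
  rewrite exchange_big [RHS]exchange_big /=; apply: eq_bigr => a _.
  under eq_bigr => x' _ do rewrite mulr_sumr.
  under [RHS]eq_bigr => x' _ do rewrite mulr_suml.
  rewrite exchange_big [RHS]exchange_big /=; apply: eq_bigr => b _.
  under eq_bigr => x' _ do rewrite mulrCA.
  under [RHS]eq_bigr => x' _ do rewrite -mulrA.
  by rewrite -!mulr_sumr Tc.
have : \sum_h (F h)^* * F h = 0.
  transitivity (\sum_y' \sum_x' (T x' y')^* * \sum_y \sum_x O y' y x' x * T x y).
    under eq_bigr => h _ do rewrite /F rmorph_sum mulr_suml.
    rewrite exchange_big /=; apply: eq_bigr => y' _.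
    under eq_bigr => h _ do rewrite rmorph_sum mulr_suml.
    rewrite exchange_big /=; apply: eq_bigr => x' _.
    rewrite mulr_sumr; under eq_bigr => h _ do rewrite mulr_sumr.
    rewrite exchange_big /=; apply: eq_bigr => y _.
    rewrite mulr_sumr; under eq_bigr => h _ do rewrite mulr_sumr.
    rewrite exchange_big /=; apply: eq_bigr => x _.
    rewrite /O mulr_suml mulr_sumr; apply: eq_bigr => h _.
    by rewrite rmorphM; ring.
  rewrite big1 // => y' _; rewrite big1 // => x' _.
  under eq_bigr => y _ do rewrite -Ocomm.
  rewrite exchange_big /= big1 ?mulr0 // => x _.
  rewrite -mulr_sumr /O exchange_big /= big1 ?mulr0 // => h _.
  by rewrite -mulr_sumr Y0 mulr0.
move=> /eqP; rewrite psumr_eq0; last by move=> h _; rewrite mulrC mul_conjC_ge0.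
by move=> /allP/(_ 1%g); rewrite mem_index_enum => /(_ isT);
  rewrite /= mulrC mul_conjC_eq0 => /eqP.
Qed.

End DoubleCommutant.

(** Ryser's formula for the permanent serves as a polarization identity: it turns a symmetrized
    product of matrix units into a combination of pure tensor powers. *)
Lemma ryser (K : comNzRingType) (N : nat) (e : 'I_N -> 'I_N -> K) :
  \sum_(p : 'S_N) \prod_k e k (p k) =
  \sum_(S : {set 'I_N}) (-1) ^+ #|~: S| * \prod_k \sum_(l in S) e k l.
Proof.
(* Inclusion-exclusion detects surjectivity of [f], which on a finite set is injectivity. *)
have sgn (f : {ffun 'I_N -> 'I_N}) :
    \sum_(S : {set 'I_N}) (-1) ^+ #|~: S| * (\prod_k (f k \in S)%:R) = (injectiveb f)%:R :> K.
  transitivity (\prod_(l < N) (1 - (l \notin codom f)%:R) : K).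
    rewrite bigA_distr /=; apply: eq_bigr => S _.
    have [h|/forallPn[k hk]] := boolP [forall k, f k \in S].
      rewrite [X in _ * X]big1 => [|k _]; last by rewrite (forallP h).
      rewrite mulr1 [RHS](bigID (mem S)) /= [X in X * _]big1 ?mul1r => [|l -> //].
      rewrite (eq_bigr (fun=> -1)) => [|l lS].
        by rewrite prodr_const; congr (_ ^+ _); apply: eq_card => l; rewrite !inE.
      rewrite (negPf lS) (_ : l \notin codom f) //.
      by apply: contra lS => /codomP[k ->]; exact: (forallP h).
    rewrite (bigD1 k) //= (negPf hk) mul0r mulr0.
    by rewrite (bigD1 (f k)) //= (negPf hk) codom_f /= oppr0 mul0r.
  case: injectiveP => [fi|fi].
    rewrite big1 // => l _; have := injF_onto fi l => ->.
    by rewrite subr0.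
  have /existsP[l hl] : [exists l, l \notin codom f].
    apply: contra_notT fi; rewrite negb_exists => /forallP h.
    apply/injectiveP; apply/(card_uniqP (s := codom f)); rewrite size_codom.
    by apply: eq_card => l; have := h l; rewrite negbK => ->.
  by rewrite (bigD1 l) //= hl subrr mul0r.
under [RHS]eq_bigr => S _ do (under eq_bigr => k _ do rewrite big_mkcond /=;
  rewrite bigA_distr_bigA /= mulr_sumr).
rewrite [RHS]exchange_big /=.
transitivity (\sum_(f : {ffun 'I_N -> 'I_N}) (injectiveb f)%:R * \prod_k e k (f k)); last first.
  apply: eq_bigr => f _; rewrite -sgn mulr_suml; apply: eq_bigr => S _.
  rewrite -mulrA -big_split /=; congr (_ * _); apply: eq_bigr => k _.
  by case: ifP; rewrite ?mul1r ?mul0r.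
rewrite [RHS](bigID (fun f : {ffun 'I_N -> 'I_N} => injectiveb f)) /=.
rewrite [X in _ + X]big1 ?addr0 => [|f /negPf ->]; last by rewrite mul0r.
rewrite [RHS](reindex_onto (fun p : 'S_N => pval p) (insubd (1%g : 'S_N))) /=; last first.
  by move=> f fi; exact: insubdK.
apply: eq_big => [p|p _].
  by have pi := valP p; rewrite [injectiveb _]pi /=; apply/esym/eqP; exact: valKd.
have pi := valP p; rewrite [injectiveb _]pi mul1r.
by apply: eq_bigr => k _; rewrite pvalE.
Qed.

(** Rectangular [A] and [B] are allowed, so that local unitaries and embeddings into a larger local
    dimension are treated alike. *)
Definition tensop (C : numClosedFieldType) N m n (A B : 'M[C]_(m, n))
    (x : copies_idx m N) (y : copies_idx n N) : C :=
  \prod_k (A (x k).1 (y k).1 * B (x k).2 (y k).2).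

Section TensorCommutant.
Variables (C : numClosedFieldType) (N d : nat).
Local Notation I := (copies_idx d N).
Implicit Types (x y z : I) (A B : 'M[C]_d) (T : I -> I -> C).

Definition tens_comm T A B :=
  forall x y, \sum_z T x z * tensop A B z y = \sum_z tensop A B x z * T z y.

(** With one factor fixed, each entry of the commutator is a form of degree [N] in the other, so
    [mxform0] frees first [A], then [B]. The boolean in [J] merges the two sums of the commutator
    into one form. *)
Lemma tens_comm_unitary T :
  (forall U V, U \is unitarymx -> V \is unitarymx -> tens_comm T U V) ->
  forall A B, tens_comm T A B.
Proof.
move=> TUV.
pose J := (bool * I)%type.
pose form x y (c : J -> C) (fst_ : bool) (A : 'M[C]_d) := \sum_(j : J) c j *
   \prod_k A (if fst_ then ((if j.1 then j.2 else x) k).1 else ((if j.1 then j.2 else x) k).2)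
              (if fst_ then ((if j.1 then y else j.2) k).1 else ((if j.1 then y else j.2) k).2).
have formE x y A B : \sum_z T x z * tensop A B z y - \sum_z tensop A B x z * T z y =
    form x y (fun j => if j.1 then T x j.2 * \prod_k B (j.2 k).2 (y k).2
                       else - (T j.2 y * \prod_k B (x k).2 (j.2 k).2)) true A.
  rewrite /form -(pair_bigA _ (fun b z => (if b then T x z * \prod_k B (z k).2 (y k).2
    else - (T z y * \prod_k B (x k).2 (z k).2)) *
    \prod_k A ((if b then z else x) k).1 ((if b then y else z) k).1)) big_bool /=.
  rewrite -sumrN; congr (_ + _); apply: eq_bigr => z _; rewrite /tensop big_split /=; ring.
have formE' x y A B : \sum_z T x z * tensop A B z y - \sum_z tensop A B x z * T z y =
    form x y (fun j => if j.1 then T x j.2 * \prod_k A (j.2 k).1 (y k).1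
                       else - (T j.2 y * \prod_k A (x k).1 (j.2 k).1)) false B.
  rewrite /form -(pair_bigA _ (fun b z => (if b then T x z * \prod_k A (z k).1 (y k).1
    else - (T z y * \prod_k A (x k).1 (z k).1)) *
    \prod_k B ((if b then z else x) k).2 ((if b then y else z) k).2)) big_bool /=.
  rewrite -sumrN; congr (_ + _); apply: eq_bigr => z _; rewrite /tensop big_split /=; ring.
have TAV A V : V \is unitarymx -> tens_comm T A V.
  move=> Vu x y; apply/eqP; rewrite -subr_eq0 formE; apply/eqP.
  apply: (@mxform0 C d N J) => U Uu; rewrite /mxform.
  by apply: etrans (esym (formE x y U V)) _; rewrite TUV // subrr.
move=> A B x y; apply/eqP; rewrite -subr_eq0 formE'; apply/eqP.
apply: (@mxform0 C d N J) => V Vu; rewrite /mxform.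
by apply: etrans (esym (formE' x y A V)) _; rewrite TAV // subrr.
Qed.

(** An orbital is a product of two permanents, one per party, so by [ryser] it is a combination of
    operators [tensop]; then [double_commutant] applies. *)
Lemma tens_commutant T : (forall A B, tens_comm T A B) ->
  exists t : 'S_N * 'S_N -> C, forall x y, T x y = \sum_h t h * (x == act_pair h y)%:R.
Proof.
move=> TAB.
apply: (@double_commutant C ('S_N * 'S_N)%type I (@act_pair N d)).
- by move=> x; apply/ffunP => k; rewrite ffunE !perm1 -surjective_pairing.
- by move=> h h' x; apply/ffunP => k; rewrite !ffunE /= !permM.
move=> a b.
pose A (S : {set 'I_N}) : 'M[C]_d :=
  \matrix_(i, j) \sum_(l in S) ((i == (a l).1) && (j == (b l).1))%:R.
pose B (S : {set 'I_N}) : 'M[C]_d :=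
  \matrix_(i, j) \sum_(l in S) ((i == (a l).2) && (j == (b l).2))%:R.
have orbE x y : orbital C (@act_pair N d) a b x y =
  \sum_S \sum_S' ((-1) ^+ #|~: S| * (-1) ^+ #|~: S'|) * tensop (A S) (B S') x y.
  transitivity ((\sum_(p : 'S_N) \prod_k (((x k).1 == (a (p k)).1) && ((y k).1 == (b (p
    k)).1))%:R) *
    (\sum_(p : 'S_N) \prod_k (((x k).2 == (a (p k)).2) && ((y k).2 == (b (p k)).2))%:R) : C).
    rewrite mulr_suml; under [RHS]eq_bigr => p _ do rewrite mulr_sumr.
    rewrite pair_bigA; apply: eq_bigr => -[p q] _ /=.
    rewrite -big_split /=; case: andP => [[/eqP -> /eqP ->]|h].
      by rewrite big1 // => k _; rewrite !ffunE /= !eqxx mulr1.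
    have [k hk] : exists k, ~~ [&& (x k).1 == (a (p k)).1, (y k).1 == (b (p k)).1,
        (x k).2 == (a (q k)).2 & (y k).2 == (b (q k)).2].
      apply/existsP; rewrite -negb_forall; apply/negP => /forallP hh; apply: h; split.
        apply/eqP/ffunP => k; rewrite ffunE /=; have /and4P[/eqP <- _ /eqP <- _] := hh k.
        exact: surjective_pairing.
      apply/eqP/ffunP => k; rewrite ffunE /=; have /and4P[_ /eqP <- _ /eqP <-] := hh k.
      exact: surjective_pairing.
    rewrite (bigD1 k) //=; move: hk.
    case: ((x k).1 == _); case: ((y k).1 == _); case: ((x k).2 == _);
      case: ((y k).2 == _) => //= _;
      by rewrite ?mul0r ?mulr0 ?mul0r.
  rewrite (ryser (fun k l => (((x k).1 == (a l).1) && ((y k).1 == (b l).1))%:R)).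
  rewrite (ryser (fun k l => (((x k).2 == (a l).2) && ((y k).2 == (b l).2))%:R)).
  rewrite mulr_suml; apply: eq_bigr => S _; rewrite mulr_sumr; apply: eq_bigr => S' _.
  rewrite mulrACA; congr (_ * _); rewrite /tensop big_split /=; congr (_ * _).
    by apply: eq_bigr => k _; rewrite mxE.
  by apply: eq_bigr => k _; rewrite mxE.
move=> x y.
under eq_bigr => z _ do rewrite orbE mulr_sumr.
under [RHS]eq_bigr => z _ do rewrite orbE mulr_suml.
rewrite exchange_big [RHS]exchange_big /=; apply: eq_bigr => S _.
under eq_bigr => z _ do rewrite mulr_sumr.
under [RHS]eq_bigr => z _ do rewrite mulr_suml.
rewrite exchange_big [RHS]exchange_big /=; apply: eq_bigr => S' _.
under eq_bigr => z _ do rewrite mulrCA.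
under [RHS]eq_bigr => z _ do rewrite -[_ * _ * T _ _]mulrA.
by rewrite -!mulr_sumr TAB.
Qed.

End TensorCommutant.

(** * Invariant testers *)

Section MinNorm.
Import all_classical topology normedtype derive numFieldNormedType.Exports.
Local Open Scope classical_set_scope.
Local Open Scope ring_scope.
Variables (R : realType) (n : nat).
Implicit Types (a t : 'rV[R]_n).

Definition rdot a t : R := \sum_i a 0 i * t 0 i.

Lemma sum_continuous (F : 'I_n -> 'rV[R]_n -> R) :
  (forall i, continuous (F i)) -> continuous (fun t => \sum_i F i t).
Proof.
move=> Fc; elim: (index_enum _) => [|i s IH].
  rewrite (_ : (fun _ => _) = fun=> 0); first exact: cst_continuous.
  by apply/funext => t; rewrite big_nil.
rewrite (_ : (fun _ => _) = F i \+ (fun t => \sum_(j <- s) F j t)).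
  by move=> t; apply: continuousD; [exact: Fc|exact: IH].
by apply/funext => t; rewrite big_cons.
Qed.

Lemma rdot_continuous a : continuous (rdot a).
Proof.
apply: sum_continuous => i t; apply: continuousM; first exact: cst_continuous.
exact: coord_continuous.
Qed.

Lemma rdot_sqr_continuous : continuous (fun t : 'rV[R]_n => rdot t t).
Proof. by apply: sum_continuous => i t; apply: continuousM; exact: coord_continuous. Qed.

(* A set satisfying all affine inequalities valid on it is an intersection of
   closed half-spaces, hence closed. *)
Lemma min_norm_exists (K : 'rV[R]_n -> Prop) : (exists t, K t) ->
  (forall t, (forall a (b : R), (forall t', K t' -> b <= rdot a t') -> b <= rdot a t) -> K t) ->
  exists2 t, K t & forall t', K t' -> rdot t t <= rdot t' t'.
Proof.
move=> [t0 K0] Kcl.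
pose D : set ('rV[R]_n * R) := [set ab | forall t', K t' -> ab.2 <= rdot ab.1 t'].
have KE : K = \bigcap_(ab in D) [set t | ab.2 <= rdot ab.1 t].
  apply/seteqP; split => [t Kt ab Dab|t ht]; first exact: Dab.
  by apply: Kcl => a b hab; exact: (ht (a, b)).
have closedK : closed K.
  rewrite KE; apply: closed_bigI => -[a b] _ /=.
  apply: (@preimage_closed _ _ (rdot a) [set x | b <= x]); last exact: closed_ge.
  by move=> t _; exact: rdot_continuous.
pose A := K `&` [set t | rdot t t <= rdot t0 t0].
have Acl : closed A.
  apply: closedI => //.
  apply: (@preimage_closed _ _ (fun t => rdot t t) [set x | x <= rdot t0 t0]);
    last exact: closed_le.
  by move=> t _; exact: rdot_sqr_continuous.
have Abd : bounded_set A.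
  exists (rdot t0 t0 + 1); split; first exact: num_real.
  move=> M hM t [_ /= ht].
  have tt0 : 0 <= rdot t t by apply: sumr_ge0 => i _; rewrite -expr2 sqr_ge0.
  rewrite /Num.norm /= mx_normrE; apply: bigmax_le => [|[i j] _ /=].
    by apply: le_trans (ltW hM); apply: addr_ge0 => //; exact: le_trans ht.
  apply: le_trans (ltW hM); rewrite ord1.
  have h1 : t 0 j ^+ 2 <= rdot t0 t0.
    apply: le_trans ht; rewrite /rdot (bigD1 j) //= -expr2 lerDl.
    by apply: sumr_ge0 => k _; rewrite -expr2 sqr_ge0.
  have h2 : `|t 0 j| ^+ 2 <= rdot t0 t0 by rewrite real_normK ?num_real.
  have := normr_ge0 (t 0 j); move: h2; move: `|_| (rdot _ _) => u v h2 u0.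
  nra.
have Ac := bounded_closed_compact Abd Acl.
have [||t tA tmin] := @compact_EVT_min _ R (fun t => rdot t t) A _ Ac.
- by exists t0; split=> //=.
- exact: continuous_subspaceT rdot_sqr_continuous.
move: tA; rewrite inE => -[Kt ht]; exists t => // t' Kt'.
have [h|h] := leP (rdot t' t') (rdot t0 t0); last exact: le_trans ht (ltW h).
by apply: tmin; rewrite inE.
Qed.

End MinNorm.

(** * Conjugation of kernels and the Hilbert-Schmidt norm *)

Section HilbertSchmidt.
Variables (C : numClosedFieldType) (I : finType).
Implicit Types (T : I -> I -> C) (v : I -> C).

Definition hs_norm T : C := \sum_x \sum_y (T x y)^* * T x y.

Lemma qform_half T T' v :
  qform (fun x y => (T x y + T' x y) / 2) v = (qform T v + qform T' v) / 2.
Proof.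
rewrite /qform -big_split mulr_suml; apply: eq_bigr => x _ /=.
by rewrite -big_split mulr_suml; apply: eq_bigr => y _ /=; field.
Qed.

Lemma isometry_norm (K : finType) (W : K -> I -> C) v :
  (forall x y, \sum_a (W a x)^* * W a y = (x == y)%:R) ->
  \sum_a (\sum_x W a x * v x)^* * (\sum_x W a x * v x) = \sum_x (v x)^* * v x.
Proof.
move=> Wi.
under eq_bigr => a _ do rewrite rmorph_sum mulr_suml.
rewrite exchange_big /=; apply: eq_bigr => x _.
under eq_bigr => a _ do rewrite mulr_sumr.
rewrite exchange_big /= (bigD1 x) //= [X in _ + X]big1 ?addr0; last first.
  move=> y yx; under eq_bigr => a _ do rewrite rmorphM mulrACA.
  by rewrite -mulr_suml Wi eq_sym (negPf yx) mul0r.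
under eq_bigr => a _ do rewrite rmorphM mulrACA.
by rewrite -mulr_suml Wi eqxx mul1r.
Qed.

Definition conj_kernel (K : finType) (W : K -> I -> C) (T : K -> K ->
  C) x y := \sum_a (W a x)^* * (\sum_b T a b * W b y).

Lemma qform_conj_kernel (K : finType) (W : K -> I -> C) (T : K -> K -> C) v :
  qform (conj_kernel W T) v = qform T (fun a => \sum_x W a x * v x).
Proof.
rewrite /qform.
transitivity (\sum_x \sum_a (v x)^* * (W a x)^* * \sum_b T a b * \sum_y W b y * v y).
  apply: eq_bigr => x _; rewrite /conj_kernel.
  under eq_bigr => y _ do rewrite mulr_sumr mulr_suml.
  rewrite exchange_big /=; apply: eq_bigr => a _.
  under eq_bigr => y _ do rewrite -!mulrA mulr_suml.
  rewrite -mulr_sumr -mulrA; congr (_ * _); rewrite -mulr_sumr; congr (_ * _).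
  rewrite exchange_big /=; apply: eq_bigr => b _; rewrite mulr_sumr.
  by apply: eq_bigr => y _; rewrite mulrA.
rewrite exchange_big /=; apply: eq_bigr => a _.
rewrite -mulr_suml; transitivity ((\sum_x W a x * v x)^* * \sum_b T a b * (\sum_y W b y * v y)).
  rewrite rmorph_sum; congr (_ * _); apply: eq_bigr => x _.
  by rewrite rmorphM mulrC.
by rewrite mulr_sumr; apply: eq_bigr => b _; rewrite mulrA.
Qed.

Lemma hs_norm_conj_kernel (W : I -> I -> C) T :
  (forall x y, \sum_a W x a * (W y a)^* = (x == y)%:R) -> hs_norm (conj_kernel W T) = hs_norm T.
Proof.
move=> Wc; rewrite /hs_norm exchange_big /=.
transitivity (\sum_y \sum_a (\sum_b T a b * W b y)^* * (\sum_b T a b * W b y)).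
  apply: eq_bigr => y _.
  apply: (@isometry_norm I (fun x a => (W a x)^*) (fun a => \sum_b T a b * W b y)) => a b.
  by rewrite -Wc; apply: eq_bigr => x _; rewrite conjCK.
rewrite exchange_big /=; apply: eq_bigr => a _.
have h := @isometry_norm I (fun y b => W b y) (T a).
rewrite -h; last first.
  by move=> x y; rewrite eq_sym -Wc; apply: eq_bigr => z _; rewrite mulrC.
by apply: eq_bigr => y _; congr (_^* * _); apply: eq_bigr => b _; rewrite mulrC.
Qed.

Lemma conj_kernel_comm (W : I -> I -> C) T x y :
  (forall x y, \sum_a W x a * (W y a)^* = (x == y)%:R) ->
  (forall x y, T x y = conj_kernel W T x y) ->
  \sum_z T x z * W z y = \sum_z W x z * T z y.
Proof.
move=> Wc TE; under [RHS]eq_bigr => z _ do rewrite TE /conj_kernel mulr_sumr.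
rewrite [RHS]exchange_big /= [RHS](bigD1 x) //= [X in _ + X]big1 ?addr0; last first.
  move=> a ax; under eq_bigr => z _ do rewrite mulrA.
  by rewrite -mulr_suml Wc eq_sym (negPf ax) mul0r.
under [RHS]eq_bigr => z _ do rewrite mulrA.
by rewrite -mulr_suml Wc eqxx mul1r.
Qed.

(** Strict convexity through the parallelogram identity: at the midpoint [hs_norm] drops by a
    quarter of its value at the difference. *)
Lemma hs_norm_minimal_eq T T' : hs_norm T' = hs_norm T ->
  hs_norm T <= hs_norm (fun x y => (T x y + T' x y) / 2) -> forall x y, T x y = T' x y.
Proof.
move=> TT' h x y.
have e : hs_norm (fun x y => (T x y + T' x y) / 2) =
    (hs_norm T + hs_norm T') / 2 - hs_norm (fun x y => T x y - T' x y) / 4.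
  rewrite /hs_norm -big_split !mulr_suml -sumrB; apply: eq_bigr => a _ /=.
  rewrite -big_split !mulr_suml -sumrB; apply: eq_bigr => b _ /=.
  by rewrite rmorphB rmorphM rmorphD fmorphV rmorph_nat; field.
have h0 : 0 <= hs_norm (fun x y => T x y - T' x y).
  by apply: sumr_ge0 => a _; apply: sumr_ge0 => b _; rewrite mulrC mul_conjC_ge0.
have hz : hs_norm (fun x y => T x y - T' x y) = 0.
  apply/eqP; rewrite eq_le h0 andbT; move: h; rewrite e TT'.
  have -> : (hs_norm T + hs_norm T) / 2 = hs_norm T by field.
  by rewrite lerDl oppr_ge0 pmulr_lle0 ?invr_gt0.
move: hz => /eqP; rewrite psumr_eq0; last first.
  by move=> a _; apply: sumr_ge0 => b _; rewrite mulrC mul_conjC_ge0.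
move=> /allP/(_ x); rewrite mem_index_enum => /(_ isT) /=; rewrite psumr_eq0; last first.
  by move=> b _; rewrite mulrC mul_conjC_ge0.
move=> /allP/(_ y); rewrite mem_index_enum => /(_ isT) /=.
by rewrite mulrC mul_conjC_eq0 subr_eq0 => /eqP.
Qed.

End HilbertSchmidt.

(** * Testers under local isometries and midpoints *)

Section Testers.
Variables (C : numClosedFieldType) (N : nat).

Lemma tensop_cols m n (U V : 'M[C]_(m, n)) (x y : copies_idx n N) :
  U^t* *m U = 1%:M -> V^t* *m V = 1%:M ->
  \sum_z (tensop U V z x)^* * tensop U V z y = (x == y)%:R.
Proof.
move=> Uu Vu.
have UE i j : \sum_k (U k i)^* * U k j = (i == j)%:R.
  by have := congr1 (fun M : 'M_n => M i j) Uu; rewrite !mxE => <-; apply: eq_bigr => k _;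
    rewrite !mxE.
have VE i j : \sum_k (V k i)^* * V k j = (i == j)%:R.
  by have := congr1 (fun M : 'M_n => M i j) Vu; rewrite !mxE => <-; apply: eq_bigr => k _;
    rewrite !mxE.
transitivity (\prod_(k < N) \sum_(c : 'I_m * 'I_m)
    (U c.1 (x k).1 * V c.2 (x k).2)^* * (U c.1 (y k).1 * V c.2 (y k).2)).
  rewrite bigA_distr_bigA; apply: eq_bigr => z _.
  by rewrite /tensop rmorph_prod -big_split.
transitivity (\prod_(k < N) (x k == y k)%:R : C).
  apply: eq_bigr => k _.
  transitivity ((\sum_i (U i (x k).1)^* * U i (y k).1) * (\sum_j (V j (x k).2)^* * V j (y k).2)).
    rewrite mulr_suml; under [RHS]eq_bigr => i _ do rewrite mulr_sumr.
    by rewrite pair_bigA; apply: eq_bigr => -[i j] _ /=; rewrite rmorphM mulrACA.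
  by rewrite UE VE -natrM mulnb -xpair_eqE -!surjective_pairing.
case: eqP => [->|ne]; first by rewrite big1 // => k _; rewrite eqxx.
have /existsP[k hk] : [exists k, x k != y k].
  rewrite -negb_forall; apply/negP => /forallP h; apply: ne; apply/ffunP => k.
  exact/eqP/h.
by rewrite (bigD1 k) //= (negPf hk) mul0r.
Qed.

Lemma unitary_isometry n (U : 'M[C]_n) : U \is unitarymx -> U^t* *m U = 1%:M.
Proof. by rewrite -trmxC_unitary => /unitarymxP; rewrite trmxCK. Qed.

Lemma tensop_rows d (U V : 'M[C]_d) (x y : copies_idx d N) :
  U \is unitarymx -> V \is unitarymx ->
  \sum_z tensop U V x z * (tensop U V y z)^* = (x == y)%:R.
Proof.
move=> Uu Vu; rewrite eq_sym -(@tensop_cols _ _ U^T V^T) ?unitary_isometry ?trmx_unitary //.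
have tr (a b : copies_idx d N) : tensop U^T V^T a b = tensop U V b a.
  by apply: eq_bigr => k _; rewrite !mxE.
by apply: eq_bigr => z _; rewrite mulrC !tr.
Qed.

Lemma tensop_tens_pow m n (U V : 'M[C]_(m, n)) (psi : 'M[C]_n) (x : copies_idx m N) :
  \sum_y tensop U V x y * tens_pow psi y = tens_pow (U *m psi *m V^T) x.
Proof.
transitivity (\prod_(k < N) \sum_(c : 'I_n * 'I_n)
    (U (x k).1 c.1 * V (x k).2 c.2) * psi c.1 c.2).
  by rewrite bigA_distr_bigA; apply: eq_bigr => y _; rewrite /tensop /tens_pow -big_split.
apply: eq_bigr => k _; rewrite mxE.
under [RHS]eq_bigr => j _ do rewrite !mxE mulr_suml.
rewrite [RHS]exchange_big /= pair_bigA; apply: eq_bigr => -[i j] _ /=.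
by rewrite mulrAC.
Qed.

Lemma uniform_schmidt_local m n (U V : 'M[C]_(m, n)) s (psi : 'M[C]_n) :
  U^t* *m U = 1%:M -> V^t* *m V = 1%:M ->
  uniform_schmidt s psi -> uniform_schmidt s (U *m psi *m V^T).
Proof.
have iso (W : 'M[C]_(m, n)) (A : 'M[C]_(n, s)) : W^t* *m W = 1%:M ->
    (map_mx Num.conj A)^T *m A = 1%:M -> (map_mx Num.conj (W *m A))^T *m (W *m A) = 1%:M.
  move=> WW AA; rewrite map_mxM trmx_mul -mulmxA (mulmxA _ W).
  have -> : (map_mx Num.conj W)^T = W^t* by apply/matrixP => i j; rewrite !mxE.
  by rewrite WW mul1mx.
move=> Uu Vu [A [B [AA [BB ->]]]]; exists (U *m A), (V *m B).
split; first exact: iso.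
split; first exact: iso.
by rewrite -scalemxAr -scalemxAl trmx_mul !mulmxA.
Qed.

Lemma usc_tester_conj m n (U V : 'M[C]_(m, n)) r Delta (T : copies_idx m N -> copies_idx m N ->
  C) :
  U^t* *m U = 1%:M -> V^t* *m V = 1%:M ->
  usc_tester r Delta T -> usc_tester r Delta (conj_kernel (@tensop C N m n U V) T).
Proof.
move=> Uu Vu [Te [Ty Tn]]; split; [|split].
- move=> v; rewrite qform_conj_kernel; have [h1 h2] := Te (fun a => \sum_x tensop U V a x * v x).
  split=> //; apply: le_trans h2 _; rewrite isometry_norm // => x y; exact: tensop_cols.
- move=> psi hpsi; rewrite qform_conj_kernel.
  have /Ty := uniform_schmidt_local Uu Vu hpsi.
  by congr (_ <= _); apply: eq_bigr => x _; apply: eq_bigr => y _; rewrite !tensop_tens_pow.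
- move=> psi hpsi; rewrite qform_conj_kernel.
  have /Tn := uniform_schmidt_local Uu Vu hpsi.
  by congr (_ <= _); apply: eq_bigr => x _; apply: eq_bigr => y _; rewrite !tensop_tens_pow.
Qed.

Lemma usc_tester_half d r Delta (T T' : copies_idx d N -> copies_idx d N -> C) :
  usc_tester r Delta T -> usc_tester r Delta T' ->
  usc_tester r Delta (fun x y => (T x y + T' x y) / 2).
Proof.
have half (a b c : C) : c <= a -> c <= b -> c <= (a + b) / 2.
  by move=> ca cb; rewrite ler_pdivlMr // mulr_natr mulr2n lerD.
have half' (a b c : C) : a <= c -> b <= c -> (a + b) / 2 <= c.
  by move=> ca cb; rewrite ler_pdivrMr // mulr_natr mulr2n lerD.
move=> [Te [Ty Tn]] [Te' [Ty' Tn']]; split; [|split].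
- move=> v; rewrite qform_half; have [h1 h2] := Te v; have [h1' h2'] := Te' v.
  by split; [exact: half|exact: half'].
- by move=> psi h; rewrite qform_half; apply: half; [exact: Ty|exact: Ty'].
- by move=> psi h; rewrite qform_half; apply: half'; [exact: Tn|exact: Tn'].
Qed.

End Testers.

Section MinimalTester.
Variables (R : realType) (N d r Delta : nat).
Local Notation C := R[i].
Local Notation toC := (real_complex R).
Local Notation I := (copies_idx d N).
Local Notation K := (I * I * bool)%type.
Implicit Types (T : I -> I -> C) (t : 'rV[R]_#|{: K}|).

(** Real coordinates make the testers a subset of a real vector space, where [hs_norm] becomes
    [rdot t t] and compactness applies. *)
Definition kernel_of t (x y : I) : C :=
  toC (t 0 (enum_rank (x, y, true))) + 'i * toC (t 0 (enum_rank (x, y, false))).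

Definition coords_of T : 'rV[R]_#|{: K}| :=
  \row_j let: (x, y, b) := enum_val j in
         if b then complex.Re (T x y) else complex.Im (T x y).

Lemma coords_ofK T x y : kernel_of (coords_of T) x y = T x y.
Proof. by rewrite /kernel_of !mxE !enum_rankK -complexiE [RHS]complexE. Qed.

Lemma sum_coords (V : nmodType) (F : K -> V) :
  \sum_(j < #|{: K}|) F (enum_val j) = \sum_x \sum_y (F (x, y, true) + F (x, y, false)).
Proof.
rewrite sum_enum_val.
transitivity (\sum_(p : I * I) \sum_(b : bool) F (p, b)).
  by rewrite pair_bigA; apply: eq_bigr => -[].
transitivity (\sum_(p : I * I) (F (p.1, p.2, true) + F (p.1, p.2, false))).
  by apply: eq_bigr => -[x y] _; rewrite big_bool.
by rewrite -(pair_bigA _ (fun x y => F (x, y, true) + F (x, y, false))).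
Qed.

Definition qcoef (v : I -> C) (j : 'I_#|{: K}|) : C :=
  let: (x, y, b) := enum_val j in (v x)^* * (if b then 1 else 'i) * v y.

Lemma qform_kernel_of t v : qform (kernel_of t) v = \sum_j qcoef v j * toC (t 0 j).
Proof.
transitivity (\sum_(j < #|{: K}|) (let: (x, y, b) :=
  enum_val j in (v x)^* * (if b then 1 else 'i) * v y) *
   toC (t 0 (enum_rank (enum_val j)))); last first.
  by apply: eq_bigr => j _; rewrite enum_valK.
rewrite (sum_coords (fun k => (let: (x, y, b) := k in (v x)^* * (if b then 1 else 'i) * v y) *
   toC (t 0 (enum_rank k)))).
apply: eq_bigr => x _; apply: eq_bigr => y _; rewrite /kernel_of /=; ring.
Qed.

Lemma hs_norm_kernel_of t : hs_norm (kernel_of t) = toC (rdot t t).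
Proof.
rewrite /rdot rmorph_sum /=.
transitivity (\sum_(j < #|{: K}|) toC (t 0 (enum_rank (enum_val j)) *
  t 0 (enum_rank (enum_val j)))); last first.
  by apply: eq_bigr => j _; rewrite enum_valK.
rewrite (sum_coords (fun k => toC (t 0 (enum_rank k) * t 0 (enum_rank k)))).
apply: eq_bigr => x _; apply: eq_bigr => y _; rewrite /kernel_of.
rewrite rmorphD !rmorphM /= conjCi !conj_toC.
have h (a b : C) : (a + - 'i * b) * (a + 'i * b) = a * a - 'i ^+ 2 * (b * b) by ring.
by rewrite h sqrCi mulN1r opprK.
Qed.

(** Being [>= 0] in the complex numbers means a zero imaginary part and a nonnegative real part,
    hence three real affine inequalities. *)
Lemma complex_ge0_closed (P : 'rV[R]_#|{: K}| -> Prop) (z0 : C) (z : 'I_#|{: K}| -> C) t :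
  (forall a (b : R), (forall t', P t' -> b <= rdot a t') -> b <= rdot a t) ->
  (forall t', P t' -> 0 <= z0 + \sum_j z j * toC (t' 0 j)) ->
  0 <= z0 + \sum_j z j * toC (t 0 j).
Proof.
move=> tP zP.
have ReE t' : complex.Re (z0 + \sum_j z j * toC (t' 0 j)) =
    complex.Re z0 + rdot (\row_j complex.Re (z j)) t'.
  rewrite raddfD /= raddf_sum; congr (_ + _); apply: eq_bigr => j _ /=.
  by rewrite mxE; case: (z j) => a b /=; rewrite mulr0 subr0.
have ImE t' : complex.Im (z0 + \sum_j z j * toC (t' 0 j)) =
    complex.Im z0 + rdot (\row_j complex.Im (z j)) t'.
  rewrite raddfD /= raddf_sum; congr (_ + _); apply: eq_bigr => j _ /=.
  by rewrite mxE; case: (z j) => a b /=; rewrite mulr0 add0r mulrC.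
have rdotN a t' : rdot (- a) t' = - rdot a t'.
  by rewrite /rdot -sumrN; apply: eq_bigr => j _; rewrite mxE mulNr.
rewrite lecE /= ReE ImE; apply/andP; split.
  rewrite eq_le; apply/andP; split.
    rewrite -lerBrDl sub0r -lerN2 opprK -rdotN; apply: tP => t' /zP.
    by rewrite lecE /= ImE rdotN => /andP[/eqP h _]; lra.
  rewrite -lerBlDl sub0r; apply: tP => t' /zP.
  by rewrite lecE /= ImE => /andP[/eqP h _]; lra.
rewrite -lerBlDl sub0r; apply: tP => t' /zP.
by rewrite lecE /= ReE => /andP[_ h]; lra.
Qed.

Lemma minimal_tester : (exists T : I -> I -> C, usc_tester r Delta T) ->
  exists2 T : I -> I -> C, usc_tester r Delta T & forall T', usc_tester r Delta T' ->
    hs_norm T <= hs_norm T'.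
Proof.
move=> [T0 T0t].
have ext T T' : (forall x y, T x y = T' x y) -> forall v, qform T v = qform T' v.
  by move=> e v; apply: eq_bigr => x _; apply: eq_bigr => y _; rewrite e.
have coordsP T : usc_tester r Delta T -> usc_tester r Delta (kernel_of (coords_of T)).
  move=> [Te [Ty Tn]]; have e := ext _ _ (coords_ofK T).
  split; [|split]; [move=> v|move=> psi|move=> psi]; rewrite e; [exact: Te|exact: Ty|exact: Tn].
have [||t tt tmin] := @min_norm_exists R _ (fun t => usc_tester r Delta (kernel_of t)).
- by exists (coords_of T0); exact: coordsP.
- move=> t tP.
  have lower v (z : C) : (forall t', usc_tester r Delta (kernel_of t') ->
    z <= qform (kernel_of t') v) ->
      z <= qform (kernel_of t) v.
    move=> zP; rewrite -subr_ge0 addrC qform_kernel_of.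
    apply: (complex_ge0_closed tP) => t' /zP.
    by rewrite -subr_ge0 addrC qform_kernel_of.
  have upper v (z : C) : (forall t', usc_tester r Delta (kernel_of t') ->
    qform (kernel_of t') v <= z) ->
      qform (kernel_of t) v <= z.
    have e t' : z - qform (kernel_of t') v = z + \sum_j - qcoef v j * toC (t' 0 j).
      by rewrite qform_kernel_of -sumrN; congr (_ + _); apply: eq_bigr => j _; rewrite mulNr.
    move=> zP; rewrite -subr_ge0 e; apply: (complex_ge0_closed tP) => t' /zP.
    by rewrite -subr_ge0 e.
  split; [|split].
  + move=> v; split; first by apply: lower => t' [h _]; case: (h v).
    by apply: upper => t' [h _]; case: (h v).
  + by move=> psi hpsi; apply: lower => t' [_ [h _]]; exact: h.
  + by move=> psi hpsi; apply: upper => t' [_ [_ h]]; exact: h.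
exists (kernel_of t) => // T' T't.
have -> : hs_norm T' = hs_norm (kernel_of (coords_of T')).
  by apply: eq_bigr => x _; apply: eq_bigr => y _; rewrite coords_ofK.
rewrite (hs_norm_kernel_of t) (hs_norm_kernel_of (coords_of T')) lecR.
by apply: tmin; exact: coordsP T't.
Qed.

(** The midpoint of the minimizer and its conjugate by a local unitary is again a tester, so strict
    convexity makes the two coincide. This replaces averaging over the unitary group. *)
Lemma symmetric_tester : (exists T : I -> I -> C, usc_tester r Delta T) ->
  exists (T : I -> I -> C) (t : 'S_N * 'S_N -> C), usc_tester r Delta T /\
    forall x y, T x y = \sum_h t h * (x == act_pair h y)%:R.
Proof.
move=> /minimal_tester[T Tt Tmin].
have [t tE] : exists t : 'S_N * 'S_N ->
  C, forall x y, T x y = \sum_h t h * (x == act_pair h y)%:R.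
  apply: tens_commutant; apply: tens_comm_unitary => U V Uu Vu x y.
  have Wr x' y' := @tensop_rows C N d U V x' y' Uu Vu.
  apply: conj_kernel_comm => //; apply: hs_norm_minimal_eq; first exact: hs_norm_conj_kernel.
  apply: Tmin; apply: usc_tester_half => //.
  by apply: usc_tester_conj => //; exact: unitary_isometry.
by exists T, t.
Qed.

End MinimalTester.

Lemma pid_isometry (C : numClosedFieldType) m n : (n <= m)%N ->
  (pid_mx n : 'M[C]_(m, n))^t* *m pid_mx n = 1%:M.
Proof.
move=> nm; rewrite tr_pid_mx map_pid_mx mul_pid_mx minnn (minn_idPr nm).
by rewrite pid_mx_1.
Qed.

Lemma usc_diag_schmidt (R : rcfType) d s : (s <= d)%N ->
  uniform_schmidt s (usc_diag R d s).
Proof.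
move=> sd; exists (pid_mx s), (pid_mx s).
have e : (map_mx Num.conj (pid_mx s : 'M[R[i]]_(d, s)))^T *m pid_mx s = 1%:M.
  rewrite -(@pid_isometry _ d s sd); congr (_ *m _).
  by apply/matrixP => i j; rewrite !mxE.
split=> //; split=> //.
rewrite tr_pid_mx mul_pid_mx !minnn.
by apply/matrixP => i j; rewrite !mxE.
Qed.

(** * The lower bound *)

Local Close Scope sesquilinear_scope.

(** The tester is first pulled back along the embedding of dimension [r + Delta] into [d], so that
    the larger rank fills the whole local space. *)
Lemma tester_lower_bound (R : realType) (d r Delta N k : nat) :
  (0 < r)%N -> (r + Delta <= d)%N -> (N <= r ^ 2)%N ->
  (exists T : copies_idx d N -> copies_idx d N -> R[i], usc_tester r Delta T) ->
  1 / 36 <= N%:R * (N%:R * ((r%:R^-1 - (r + Delta)%:R^-1) ^+ 2 / 2) +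
    (2 / r%:R) ^+ (2 * k) * ((2 * k)`!%:R * N%:R ^+ k)) :> R.
Proof.
move=> r0 rDd Nr [T0 T0t]; set e := (X in _ <= N%:R * X).
have iso := @pid_isometry R[i] d (r + Delta) rDd.
have [|T [t [Tt tE]]] := @symmetric_tester R N (r + Delta) r Delta.
  by exists (conj_kernel (@tensop R[i] N _ _ (pid_mx (r + Delta)) (pid_mx (r + Delta))) T0);
    exact: usc_tester_conj.
have [Te [Ty Tn]] := Tt.
have [P [c [Pu Pc]]] := jucys_murphy_diag R N.
have rd : (0 < r <= r + Delta)%N by rewrite r0 leq_addr.
have h1 := tester_bhattacharyya Pu Pc rd tE Te
  (Ty _ (usc_diag_schmidt R (leq_addr _ _))) (Tn _ (usc_diag_schmidt R (leqnn _))).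
have h2 := bhattacharyya_ge Pu Pc k rd Nr; rewrite -/e in h2.
have gp : 0 < #|{: 'S_N}|%:R :> R by rewrite ltr0n; apply/card_gt0P; exists 1%g.
have := le_trans h2 h1; rewrite [leRHS]mulrC ler_pM2l //; lra.
Qed.

Lemma invr_sub_le (R : realFieldType) (r D : R) : 0 < r -> 0 <= D ->
  0 <= r^-1 - (r + D)^-1 <= D / r ^+ 2.
Proof.
move=> r0 D0; have rD : 0 < r + D by lra.
have -> : r^-1 - (r + D)^-1 = D / (r * (r + D)) by field; rewrite !gt_eqF.
apply/andP; split; first by rewrite divr_ge0 // mulr_ge0 // ltW.
apply: ler_wpM2l => //; rewrite lef_pV2 ?posrE ?exprn_gt0 ?mulr_gt0 //.
by rewrite expr2 ler_pM2l // lerDl.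
Qed.

(* S(UniformSchmidtCoefficients^{r,Delta}) = Omega^*(r^2/Delta): for every
   eps > 0 there is c > 0 such that every N admitting a tester satisfies
   N >= c * r^(2-eps) / Delta. *)
Theorem theorem4p12 (R : realType) (eps : R) (heps : 0 < eps) :
  exists c : R, 0 < c /\
    forall (d r Delta N : nat),
      (1 <= r)%N -> (1 <= Delta)%N -> (r + Delta <= d)%N ->
      (exists T : copies_idx d N -> copies_idx d N -> R[i],
          usc_tester r Delta T) ->
      c * ((r%:R : R) `^ (2 - eps)) / (Delta%:R) <= N%:R.
Proof.
(* Ensures [(2 - eps) * (k + 1) <= 2 * k], hence [rho ^+ k.+1 <= r ^ (2k)] below. *)
have [k hk] : exists k : nat, 2 <= eps * k.+1%:R.
  have h : 0 <= 2 / eps by rewrite divr_ge0 // ltW.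
  exists (Num.bound (2 / eps)); have := archi_boundP h.
  rewrite ltr_pdivrMr // => /ltW h1; apply: le_trans h1 _.
  by rewrite mulrC ler_wpM2l ?ler_nat // ltW.
(* The constant of the moment term: [(2 / r) ^ (2k) * (2k)! = D / r ^ (2k)]. *)
pose D : R := 4 ^+ k * (2 * k)`!%:R.
have D1 : 1 <= D.
  rewrite -[1]mulr1 ler_pM //; first by rewrite exprn_ege1 // ler1n.
  by rewrite ler1n fact_gt0.
(* Makes the moment term at most [c * D = 1/100] and the main term at most 1/200, which together
   stay below 1/36. *)
pose c : R := (100 * D)^-1.
have c0 : 0 < c by rewrite invr_gt0 mulr_gt0 // (lt_le_trans _ D1).
have cD : c * D = 1 / 100.
  by rewrite /c invfM -mulrA mulVf ?gt_eqF ?(lt_le_trans _ D1) // mulr1 mul1r.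
have c1 : c <= 1 / 100 by rewrite -cD ler_peMr // ltW.
exists c; split=> // d r Delta N r1 D1' rDd ex; rewrite leNgt; apply/negP => Nlt.
have r1R : 1 <= r%:R :> R by rewrite ler1n.
have r0R : 0 < r%:R :> R by rewrite ltr0n.
have De1 : 1 <= Delta%:R :> R by rewrite ler1n.
set rho := r%:R `^ (2 - eps) in Nlt.
have rho0 : 0 <= rho by exact: powR_ge0.
have rho2 : rho <= r%:R ^+ 2.
  by rewrite -powR_mulrn ?ler0n // ler_powR // lerBlDr lerDl ltW.
have rhok : rho ^+ k.+1 <= r%:R ^+ (2 * k).
  rewrite -powR_mulrn // -powRrM -powR_mulrn ?ler0n // ler_powR //.
  have -> : (2 * k)%:R = 2 * k.+1%:R - 2 :> R by rewrite natrM -natr1; ring.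
  by rewrite mulrBl lerB.
set NR := N%:R : R in Nlt.
have N0 : 0 <= NR by rewrite ler0n.
have N1 : NR <= c * rho.
  apply: le_trans (ltW Nlt) _; rewrite ler_pdivrMr ?ltr0n //.
  by rewrite ler_peMr // mulr_ge0 // ltW.
have N2 : NR * Delta%:R <= c * rho by rewrite -ler_pdivlMr ?ltr0n // ltW.
have Nr : (N <= r ^ 2)%N.
  rewrite -(ler_nat R) natrX; apply: le_trans N1 _.
  apply: le_trans rho2; rewrite ler_piMl //; lra.
have := tester_lower_bound k r1 rDd Nr ex; rewrite -/NR.
have /andP[dl0 dlD] := invr_sub_le r0R (ler0n R Delta); rewrite -natrD in dl0 dlD.
set delta := _ - _ in dl0 dlD *.
(* The factor [Delta] enters here: [delta <= Delta / r ^ 2] while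
   [N * Delta <= c * rho <= c * r ^ 2]. *)
have Nd : NR * delta <= c.
  apply: le_trans (ler_wpM2l N0 dlD) _; rewrite mulrA ler_pdivrMr ?exprn_gt0 //.
  by apply: le_trans N2 _; rewrite ler_wpM2l // ltW.
have Nd0 : 0 <= NR * delta by exact: mulr_ge0.
have Nk : NR ^+ k.+1 * ((2 / r%:R) ^+ (2 * k) * (2 * k)`!%:R) <= c * D.
  have h1 : NR ^+ k.+1 <= c * r%:R ^+ (2 * k).
    apply: le_trans (_ : _ <= (c * rho) ^+ k.+1) _;
      first by rewrite lerXn2r ?nnegrE ?mulr_ge0 // ltW.
    rewrite exprMn ler_pM ?exprn_ge0 ?(ltW c0) //.
    by rewrite exprS ler_piMr ?(ltW c0) // exprn_ile1 ?(ltW c0) //; lra.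
  have -> : c * D = c * r%:R ^+ (2 * k) * ((2 / r%:R) ^+ (2 * k) * (2 * k)`!%:R).
    have rk : r%:R ^+ (2 * k) != 0 :> R by rewrite expf_neq0 // gt_eqF.
    rewrite /D expr_div_n [2 ^+ _]exprM (_ : 2 ^+ 2 = 4); last by ring.
    by move: (r%:R ^+ _) rk (4 ^+ k) => x x0 y; field.
  by apply: ler_wpM2r h1; rewrite mulr_ge0 ?exprn_ge0 ?divr_ge0 ?ler0n.
have key (n dl x y z : R) :
    n * (n * (dl ^+ 2 / 2) + x * (y * z)) = (n * dl) ^+ 2 / 2 + n * z * (x * y) by ring.
rewrite key -exprS.
move: Nk; rewrite cD; move: (_ ^+ k.+1 * _) => z hz.
have : (NR * delta) ^+ 2 <= c ^+ 2 by rewrite lerXn2r ?nnegrE // ltW.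
have : c ^+ 2 <= 1 / 100 by rewrite expr2; nra.
move: ((NR * delta) ^+ 2) (c ^+ 2) => u v; lra.
Qed.
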